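(* Let $q\ge1$ be an integer and let $G$ be a group. Then: (1) $\gamma_*^{(q)}(G)=\gamma_*(G)^{(q)}$ is an $N$-series. Moreover, if a group $K$ acts on a group $H$ by automorphisms, then: (2) $\gamma_*^{(q)}(H\rtimes K)=\gamma_*^K(H)^{(q)}\rtimes\gamma_*^{(q)}(K)$ (termwise); (3) if $K$ acts trivially on $H^{\mathrm{ab}}\otimes(\mathbb Z/q)$, then $\gamma_*^K(H)^{(q)}=\gamma_*^{(q)}(H)$. In particular, if $K$ acts trivially on $H^{\mathrm{ab}}\otimes(\mathbb Z/q)\cong H_1(H,\mathbb Z/q)$ (that is, if $H\rtimes K$ is a $q$-almost direct product), then there is a canonical isomorphism of graded Lie rings $\mathrm{gr}_*^{(q)}(H\rtimes K)\cong\mathrm{gr}_*^{(q)}(H)\rtimes\mathrm{gr}_*^{(q)}(K)$, which also preserves the $q$-power operation.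
   Context: Commutators are $[a,b]=aba^{-1}b^{-1}$; $[A,B]$ is the subgroup generated by the $[a,b]$; $A^q$ is the subgroup generated by the $a^q$, $a\in A$. A filtration $G_*$ on a group $G$ is a sequence of subgroups $G=G_1\supseteq G_2\supseteq\cdots$. It is central if $[G,G_i]\subseteq G_{i+1}$ for all $i$; an $N$-series if $[G_i,G_j]\subseteq G_{i+j}$ for all $i,j$; a central filtration is of $q$-torsion if $G_i^q\subseteq G_{i+1}$ for all $i$. For an $N$-series, $\mathrm{gr}(G_* )=\bigoplus_{i\ge1}G_i/G_{i+1}$ is a graded Lie ring with bracket induced by commutators. For a central filtration $G_*$, $G_*^{(q)}$ denotes the smallest $q$-torsion central filtration on $G_1$ containing $G_*$ (it exists). $\gamma_*(G)$ is the lower central series; the $q$-torsion lower central series $\gamma_*^{(q)}(G)$ is the smallest $q$-torsion central filtration on $G$, and $\mathrm{gr}_*^{(q)}(G)=\mathrm{gr}(\gamma_*^{(q)}(G))$. If $K$ acts on $H$, then $\gamma_1^K(H)=H$ and $\gamma_{n+1}^K(H)=[H\rtimes K,\gamma_n^K(H)]$ (in $H\rtimes K$). If $G_*$ is a $q$-torsion central filtration, the $q$-power operation on $\mathrm{gr}(G_* )$ is the family of (well-defined) maps $\mathrm{gr}_i(G_* )\to\mathrm{gr}_{i+1}(G_* )$ induced by $g\mapsto g^q$. If $K_*$ and $H_*$ are $N$-series and $[K_j,H_i]\subseteq H_{i+j}$ in $H\rtimes K$ for all $i,j\ge1$, then the subgroups $H_i\rtimes K_i$ form an $N$-series $H_*\rtimes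 K_*$, $\mathrm{gr}(K_* )$ acts on $\mathrm{gr}(H_* )$ by derivations via $\bar k\cdot\bar h=\overline{(k\cdot h)h^{-1}}$, and $\mathrm{gr}(H_* )\rtimes\mathrm{gr}(K_* )$ is the direct sum with bracket $[(h,k),(h',k')]=([h,h']+k\cdot h'-k'\cdot h,[k,k'])$; it is canonically identified with $\mathrm{gr}(H_*\rtimes K_* )$. This applies to $H_*=\gamma_*^{(q)}(H)$, $K_*=\gamma_*^{(q)}(K)$ in the last statement; the $q$-power operation on $\mathrm{gr}_*^{(q)}(H)\rtimes\mathrm{gr}_*^{(q)}(K)$ is the one of the $q$-torsion $N$-series $H_*\rtimes K_*$ under this identification (it restricts to the $q$-power operations of the two factors). *)

(* Defs.v *)
From HB Require Import structures.
From mathcomp Require Import all_boot all_order all_algebra.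
From mathcomp Require Import all_classical.
From mathcomp Require Import generic_quotient ring_quotient freeg.

Set Implicit Arguments.
Unset Strict Implicit.
Unset Printing Implicit Defensive.

Import GRing.Theory.

Local Open Scope classical_set_scope.
Local Open Scope group_scope.
Local Open Scope quotient_scope.

(* Groups are MathComp's (possibly infinite) [groupType]s, and subgroups of G  *)
(* are terms of [set G]. MathComp's [~ x, y] is x^-1 y^-1 x y, which is not    *)
(* the convention used here.                                                   *)

Section Subgroups.
Variable G : groupType.
Implicit Types (A B : set G) (a b : G).

Definition is_subgroup A := A 1 /\ forall a b, A a -> A b -> A (a / b).

Definition gen A : set G := smallest is_subgroup A.

Definition cmt a b : G := a * b * a^-1 * b^-1.

Definition cmt_subgroup A B : set G := gen [set cmt a b | a in A & b in B].

Definition pow_subgroup (q : nat) A : set G := gen [set a ^+ q | a in A].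

Lemma subgroup1 A : is_subgroup A -> A 1. Proof. by case. Qed.

Lemma subgroupV A a : is_subgroup A -> A a -> A a^-1.
Proof. by move=> [A1 AF] Aa; rewrite -div1g; apply: AF. Qed.

Lemma subgroupM A a b : is_subgroup A -> A a -> A b -> A (a * b).
Proof.
by move=> sA Aa Ab; rewrite -(invgK b); apply: sA.2 => //; apply: subgroupV.
Qed.

Lemma subgroupX A a n : is_subgroup A -> A a -> A (a ^+ n).
Proof.
move=> sA Aa; elim: n => [|n IH]; first exact: subgroup1.
by rewrite expgS; apply: subgroupM.
Qed.

Lemma subgroup_bigcap (I : Type) (P : set I) (F : I -> set G) :
  (forall i, P i -> is_subgroup (F i)) -> is_subgroup (\bigcap_(i in P) F i).
Proof.
move=> sF; split=> [i Pi|a b Fa Fb i Pi]; first by case: (sF i Pi).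
by apply: (sF i Pi).2; [exact: Fa|exact: Fb].
Qed.

Lemma gen_subgroup A : is_subgroup (gen A).
Proof. by apply: subgroup_bigcap => B []. Qed.

Lemma gen_min A B : is_subgroup B -> A `<=` B -> gen A `<=` B.
Proof. by move=> sB AB; apply: smallest_sub. Qed.

Lemma sub_gen A : A `<=` gen A.
Proof. exact: sub_gen_smallest. Qed.

Lemma cmt_subgroupP A B C : is_subgroup C ->
  (cmt_subgroup A B `<=` C) <-> (forall a b, A a -> B b -> C (cmt a b)).
Proof.
move=> sC; split=> [h a b Aa Bb|h].
  by apply: h; apply: sub_gen; exists a => //; exists b.
by apply: gen_min => // _ [a Aa [b Bb <-]]; apply: h.
Qed.

Lemma pow_subgroupP q A C : is_subgroup C ->
  (pow_subgroup q A `<=` C) <-> (forall a, A a -> C (a ^+ q)).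
Proof.
move=> sC; split=> [h a Aa|h].
  by apply: h; apply: sub_gen; exists a.
by apply: gen_min => // _ [a Aa <-]; apply: h.
Qed.

End Subgroups.

(* A filtration G = G_1 >= G_2 >= ... is indexed by [nat] with the convention  *)
(* G_0 = G. Every inclusion below that involves the index 0 follows from those *)
(* with positive indices, and gr_0 = G_0 / G_1 is trivial.                     *)

Section Filtrations.
Variable G : groupType.
Implicit Types (F E : nat -> set G) (q : nat).

Definition is_filtration F :=
  [/\ F 0%N = setT, F 1%N = setT, forall i, is_subgroup (F i) &
      forall i, F i.+1 `<=` F i].

Definition is_central F :=
  is_filtration F /\ forall i, cmt_subgroup setT (F i) `<=` F i.+1.

Definition is_nseries F :=
  is_filtration F /\ forall i j, cmt_subgroup (F i) (F j) `<=` F (i + j)%N.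

Definition is_qtorsion q F := forall i, pow_subgroup q (F i) `<=` F i.+1.

(* The smallest q-torsion central filtration containing F is the termwise      *)
(* intersection of all of them: see qtors_closure_qtorsion. Likewise for qlcs. *)
Definition qtors_closure q F : nat -> set G := fun i =>
  \bigcap_(E in [set E | [/\ is_central E, is_qtorsion q E &
                             forall j, F j `<=` E j]]) E i.

(* gamma_n = [G, -] iterated n - 1 times from gamma_1 = G *)
Definition lcs : nat -> set G := fun n => iter n.-1 (cmt_subgroup setT) setT.

Definition qlcs q : nat -> set G := fun i =>
  \bigcap_(E in [set E | is_central E /\ is_qtorsion q E]) E i.

Lemma filt_sub F i : is_filtration F -> is_subgroup (F i).
Proof. by case. Qed.

Lemma filt_le F i j : is_filtration F -> (i <= j)%N -> F j `<=` F i.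
Proof.
move=> [_ _ _ dF] /subnK <-; elim: (j - i)%N => [//|n IH].
by rewrite addSn; apply: subset_trans (dF _) IH.
Qed.

Lemma centralP F i a b : is_central F -> F i b -> F i.+1 (cmt a b).
Proof.
move=> [fF cF].
have [h _] := cmt_subgroupP setT (F i) (filt_sub i.+1 fF).
exact: (h (cF i) a b Logic.I).
Qed.

Lemma nseriesP F i j a b :
  is_nseries F -> F i a -> F j b -> F (i + j)%N (cmt a b).
Proof.
move=> [fF cF].
have [h _] := cmt_subgroupP (F i) (F j) (filt_sub (i + j)%N fF).
exact: (h (cF i j)).
Qed.

Lemma qtorsionP q F i a :
  is_filtration F -> is_qtorsion q F -> F i a -> F i.+1 (a ^+ q).
Proof.
move=> fF tF; have [h _] := pow_subgroupP q (F i) (filt_sub i.+1 fF).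
exact: (h (tF i)).
Qed.

Lemma nseries_central F : is_nseries F -> is_central F.
Proof.
move=> nF; split; first by case: nF.
move=> i; rewrite -add1n; case: (nF) => -[_ F1 _ _] h.
by move: (h 1%N i); rewrite F1.
Qed.

Lemma bigcap_qtorsion q (P : set (nat -> set G)) :
    P `<=` [set E | is_central E /\ is_qtorsion q E] ->
  let F := fun i => \bigcap_(E in P) E i in is_central F /\ is_qtorsion q F.
Proof.
move=> PE F.
have sF i : is_subgroup (F i).
  by apply: subgroup_bigcap => E /PE [[[]]].
split; first split; first split=> //.
- by apply/seteqP; split=> // x _ E /PE [[[-> _ _ _] _]].
- by apply/seteqP; split=> // x _ E /PE [[[_ -> _ _] _]].
- by move=> i x Fx E PEE; case: (PE E PEE) => -[[_ _ _ d] _] _; exact: (d i x (Fx E PEE)).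
- move=> i; apply/(cmt_subgroupP _ _ (sF _)) => a b _ Fb E PEE.
  by apply: centralP (Fb E PEE); case: (PE E PEE).
- move=> i; apply/(pow_subgroupP _ _ (sF _)) => a Fa E PEE.
  by case: (PE E PEE) => -[fE _] tE; apply: qtorsionP (Fa E PEE).
Qed.

Lemma qtors_closure_qtorsion q F :
  is_central (qtors_closure q F) /\ is_qtorsion q (qtors_closure q F).
Proof. by apply: bigcap_qtorsion => E []. Qed.

Lemma sub_qtors_closure q F i : F i `<=` qtors_closure q F i.
Proof. by move=> x Fx E [_ _]; apply. Qed.

Lemma qlcs_qtorsion q : is_central (qlcs q) /\ is_qtorsion q (qlcs q).
Proof. by apply: bigcap_qtorsion. Qed.

End Filtrations.

Arguments lcs : clear implicits.
Arguments qlcs : clear implicits.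

Record ab_section (G : groupType) := AbSection {
  num : set G;
  den : set G;
  num_subgroup : is_subgroup num;
  den_subgroup : is_subgroup den;
  den_num : den `<=` num;
  cmt_den : cmt_subgroup num num `<=` den }.

Section AbelianQuotient.
Variables (G : groupType) (S : ab_section G).
Local Notation A := (num S).
Local Notation B := (den S).
Implicit Types x y : G.

Let sA := num_subgroup S.
Let sB := den_subgroup S.

Lemma sec_cmt x y : A x -> A y -> B (cmt x y).
Proof.
have [h _] := cmt_subgroupP A A sB.
by move=> Ax Ay; apply: (h (@cmt_den G S)).
Qed.

Definition sec_num := {x : G | x \in A}.

Definition sec_equiv (x y : sec_num) : bool := (val x / val y) \in B.

Lemma sec_equivP : equiv_class_of sec_equiv.
Proof.
split=> [x|x y|y x z]; rewrite /sec_equiv.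
- by apply/mem_set; rewrite mulgV; apply: subgroup1.
- by apply/idP/idP => /set_mem /(subgroupV sB) h; apply/mem_set; rewrite -invgF.
- move=> /set_mem h1 /set_mem h2; apply/mem_set.
  by rewrite -(divgKA (val y)); apply: subgroupM.
Qed.

Canonical sec_equiv_rel := EquivRelPack sec_equivP.

Definition ab_quot := {eq_quot sec_equiv}.
HB.instance Definition _ := Choice.on ab_quot.

Definition sec_one : sec_num := exist _ 1 (mem_set (subgroup1 sA)).

(* the class of x in A / B (and 0 if x is not in A) *)
Definition cls x : ab_quot := \pi_ab_quot (insubd sec_one x).

Definition rep (u : ab_quot) : G := val (repr u).

Lemma rep_num u : A (rep u).
Proof. exact: set_mem (valP (repr u)). Qed.

Lemma repK u : cls (rep u) = u.
Proof. by rewrite /cls /rep valKd reprK. Qed.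

Lemma clsP x y : A x -> A y -> cls x = cls y <-> B (x / y).
Proof.
move=> /mem_set Ax /mem_set Ay; rewrite /cls; split.
  move=> /eqmodP; rewrite /= /sec_equiv !insubdK //; exact: set_mem.
by move=> h; apply/eqmodP; rewrite /= /sec_equiv !insubdK //; apply/mem_set.
Qed.

Lemma cls_rep x : A x -> B (rep (cls x) / x).
Proof. by move=> Ax; apply/clsP; rewrite ?repK //; apply: rep_num. Qed.

Lemma den_conj x d : A x -> B d -> B (x * d * x^-1).
Proof.
move=> Ax Bd; have := subgroupM sB (sec_cmt Ax (den_num Bd)) Bd.
by rewrite /cmt mulgVK.
Qed.

Lemma eq_cls_mul x x' y y' : A x -> A x' -> A y -> A y' ->
  cls x = cls x' -> cls y = cls y' -> cls (x * y) = cls (x' * y').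
Proof.
move=> Ax Ax' Ay Ay' /(clsP Ax Ax') h /(clsP Ay Ay') k.
apply/clsP; try exact: subgroupM.
have := subgroupM sB (den_conj Ax k) h.
by rewrite invgM !mulgA mulgVK.
Qed.

Definition quot_add (u v : ab_quot) := cls (rep u * rep v).
Definition quot_opp (u : ab_quot) := cls (rep u)^-1.

Lemma quot_addE x y : A x -> A y -> quot_add (cls x) (cls y) = cls (x * y).
Proof. by move=> Ax Ay; apply: eq_cls_mul; rewrite ?repK //; apply: rep_num. Qed.

Lemma quot_addC : commutative quot_add.
Proof.
move=> u v; apply/clsP; try by apply: subgroupM => //; apply: rep_num.
by rewrite invgM mulgA; apply: sec_cmt; apply: rep_num.
Qed.

Lemma quot_addA : associative quot_add.
Proof.
move=> u v w; rewrite -(repK u) -(repK v) -(repK w).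
by rewrite !quot_addE ?mulgA //; try apply: subgroupM => //; exact: rep_num.
Qed.

Lemma quot_add0 : left_id (cls 1) quot_add.
Proof.
move=> u; rewrite -{1}(repK u) quot_addE ?mul1g ?repK //; last exact: rep_num.
exact: subgroup1.
Qed.

Lemma quot_addN : left_inverse (cls 1) quot_opp quot_add.
Proof.
move=> u; rewrite -{2}(repK u) quot_addE ?mulVg //; last exact: rep_num.
by apply: subgroupV => //; apply: rep_num.
Qed.

HB.instance Definition _ :=
  GRing.isZmodule.Build ab_quot quot_addA quot_addC quot_add0 quot_addN.

Local Open Scope ring_scope.

Lemma clsM x y : A x -> A y -> cls (x * y)%g = cls x + cls y.
Proof. by move=> Ax Ay; rewrite -quot_addE. Qed.

Lemma cls1 : cls 1%g = 0. Proof. by []. Qed.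

Lemma cls_den x : B x -> cls x = 0.
Proof.
move=> Bx; rewrite -cls1; apply/clsP; first exact: den_num.
  exact: subgroup1.
by rewrite divg1.
Qed.

Lemma cls_eq0 x : A x -> cls x = 0 -> B x.
Proof. by move=> Ax /(clsP Ax (subgroup1 sA)); rewrite divg1. Qed.

Lemma clsV x : A x -> cls x^-1%g = - cls x.
Proof.
move=> Ax; apply/eqP; rewrite -addr_eq0 -clsM ?mulVg ?cls1 //.
exact: subgroupV.
Qed.

End AbelianQuotient.

Section LieRings.
Local Open Scope ring_scope.

(* Graded Lie rings, given by their homogeneous components. The bracket of     *)
(* elements of degrees i and j lives in degree k for any proof of i + j = k,   *)
(* so that no transport is needed in the Jacobi identity.                      *)
Record glie := GLie {
  glie_comp :> nat -> zmodType;
  br : forall i j k, (i + j)%N = k -> glie_comp i -> glie_comp j -> glie_comp k;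
  brDl : forall i j k (e : (i + j)%N = k) x x' y,
    br e (x + x') y = br e x y + br e x' y;
  brDr : forall i j k (e : (i + j)%N = k) x y y',
    br e x (y + y') = br e x y + br e x y';
  brxx : forall i k (e : (i + i)%N = k) x, br e x x = 0;
  br_anti : forall i j k (e : (i + j)%N = k) (e' : (j + i)%N = k) x y,
    br e x y = - br e' y x;
  br_jacobi : forall i j k ij jk ki n
    (e1 : (i + j)%N = ij) (e2 : (ij + k)%N = n)
    (f1 : (j + k)%N = jk) (f2 : (jk + i)%N = n)
    (g1 : (k + i)%N = ki) (g2 : (ki + j)%N = n) x y z,
    br e2 (br e1 x y) z + br f2 (br f1 y z) x + br g2 (br g1 z x) y = 0 }.

Definition is_glie_iso (L M : glie) (f : forall i, L i -> M i) :=
  [/\ forall i, bijective (f i),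
      forall i x y, f i (x + y) = f i x + f i y &
      forall i j k (e : (i + j)%N = k) x y,
        f k (br e x y) = br e (f i x) (f j y)].

(* graded actions of M on L by derivations *)
Record glie_action (M L : glie) := GLieAction {
  gact : forall i j k, (i + j)%N = k -> M i -> L j -> L k;
  gactDl : forall i j k (e : (i + j)%N = k) m m' x,
    gact e (m + m') x = gact e m x + gact e m' x;
  gactDr : forall i j k (e : (i + j)%N = k) m x x',
    gact e m (x + x') = gact e m x + gact e m x';
  gact_der : forall i j k ij ik jk n
    (ejk : (j + k)%N = jk) (e : (i + jk)%N = n)
    (eij : (i + j)%N = ij) (f : (ij + k)%N = n)
    (eik : (i + k)%N = ik) (g : (j + ik)%N = n) m x y,
    gact e m (br ejk x y) = br f (gact eij m x) y + br g x (gact eik m y);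
  gact_br : forall i j k ij jk ik n
    (eij : (i + j)%N = ij) (e : (ij + k)%N = n)
    (ejk : (j + k)%N = jk) (f : (i + jk)%N = n)
    (eik : (i + k)%N = ik) (g : (j + ik)%N = n) m m' x,
    gact e (br eij m m') x = gact f m (gact ejk m' x) - gact g m' (gact eik m x) }.

Lemma br_eq (L : glie) i j k (e e' : (i + j)%N = k) (x : L i) (y : L j) :
  br e x y = br e' x y.
Proof. by rewrite (eq_irrelevance e e'). Qed.

Lemma gact_eq (M L : glie) (a : glie_action M L) i j k (e e' : (i + j)%N = k)
  (x : M i) (y : L j) : gact a e x y = gact a e' x y.
Proof. by rewrite (eq_irrelevance e e'). Qed.

Lemma br0l (L : glie) i j k (e : (i + j)%N = k) (y : L j) : br e (0 : L i) y = 0.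
Proof. by apply: (addrI (br e (0 : L i) y)); rewrite -brDl !addr0. Qed.

Lemma br0r (L : glie) i j k (e : (i + j)%N = k) (x : L i) : br e x (0 : L j) = 0.
Proof. by apply: (addrI (br e x (0 : L j))); rewrite -brDr !addr0. Qed.

Lemma brNl (L : glie) i j k (e : (i + j)%N = k) (x : L i) (y : L j) :
  br e (- x) y = - br e x y.
Proof. by apply/eqP; rewrite -addr_eq0 -brDl addNr br0l. Qed.

Lemma brNr (L : glie) i j k (e : (i + j)%N = k) (x : L i) (y : L j) :
  br e x (- y) = - br e x y.
Proof. by apply/eqP; rewrite -addr_eq0 -brDr addNr br0r. Qed.

Section SemiDirect.
Variables (M L : glie) (a : glie_action M L).

Lemma gact0r i j k (e : (i + j)%N = k) (m : M i) : gact a e m (0 : L j) = 0.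
Proof. by apply: (addrI (gact a e m (0 : L j))); rewrite -gactDr !addr0. Qed.

Lemma gactNr i j k (e : (i + j)%N = k) (m : M i) (x : L j) :
  gact a e m (- x) = - gact a e m x.
Proof. by apply/eqP; rewrite -addr_eq0 -gactDr addNr gact0r. Qed.

Definition sd_comp i : zmodType := (L i * M i)%type.

Definition sd_br i j k (e : (i + j)%N = k) (u : sd_comp i) (v : sd_comp j) :
  sd_comp k :=
  (br e u.1 v.1 + gact a e u.2 v.1 - gact a (etrans (addnC j i) e) v.2 u.1,
   br e u.2 v.2).

Lemma sd_brDl i j k (e : (i + j)%N = k) x x' y :
  sd_br e (x + x') y = sd_br e x y + sd_br e x' y.
Proof.
rewrite /sd_br /= !(brDl, gactDl, gactDr); congr (_, _) => /=.
by rewrite opprD !addrA [LHS](ACl (1*3*5*2*4*6)).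
Qed.

Lemma sd_brDr i j k (e : (i + j)%N = k) x y y' :
  sd_br e x (y + y') = sd_br e x y + sd_br e x y'.
Proof.
rewrite /sd_br /= !(brDr, gactDl, gactDr); congr (_, _) => /=.
by rewrite opprD !addrA [LHS](ACl (1*3*5*2*4*6)).
Qed.

Lemma sd_brxx i k (e : (i + i)%N = k) x : sd_br e x x = 0.
Proof. by rewrite /sd_br !brxx add0r (gact_eq a _ e) subrr. Qed.

Lemma sd_br_anti i j k (e : (i + j)%N = k) (e' : (j + i)%N = k) x y :
  sd_br e x y = - sd_br e' y x.
Proof.
rewrite /sd_br; congr (_, _) => /=; last exact: br_anti.
rewrite (br_anti e e') (gact_eq a _ e') (gact_eq a (etrans _ _) e).
by rewrite !opprD opprK -!addrA; congr (_ + _); rewrite addrC.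
Qed.

Lemma sd_br_jacobi_term i j k ij jk ki n
  (e1 : (i + j)%N = ij) (e2 : (ij + k)%N = n)
  (f1 : (j + k)%N = jk) (f2 : (jk + i)%N = n)
  (g1 : (k + i)%N = ki) (g2 : (ki + j)%N = n)
  (e1' : (j + i)%N = ij) (e2' : (k + ij)%N = n)
  (f1' : (k + j)%N = jk) (f2' : (i + jk)%N = n)
  (g1' : (i + k)%N = ki) (g2' : (j + ki)%N = n)
  (u : sd_comp i) (v : sd_comp j) (w : sd_comp k) :
  (sd_br e2 (sd_br e1 u v) w).1 =
  br e2 (br e1 u.1 v.1) w.1
  + (br e2 (gact a e1 u.2 v.1) w.1 - br g2 (gact a g1 w.2 u.1) v.1)
  + (br f2 (gact a f1' w.2 v.1) u.1 - br e2 (gact a e1' v.2 u.1) w.1)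
  + (gact a f2' u.2 (gact a f1 v.2 w.1) - gact a e2' w.2 (gact a e1 u.2 v.1))
  + (gact a e2' w.2 (gact a e1' v.2 u.1) - gact a g2' v.2 (gact a g1' u.2 w.1)).
Proof.
rewrite /= (gact_eq a (etrans _ e1) e1') (gact_eq a (etrans _ e2) e2').
rewrite !(brDl, brNl, gactDr, gactNr) (gact_br a e1 e2 f1 f2' g1' g2').
rewrite (gact_der a e1 e2' g1 g2 f1' f2') (br_anti f2' f2).
rewrite !opprD !opprK !addrA.
by rewrite [LHS](ACl (1*2*6*7*3*4*8*9*5)).
Qed.

Lemma sd_br_jacobi : forall i j k ij jk ki n
    (e1 : (i + j)%N = ij) (e2 : (ij + k)%N = n)
    (f1 : (j + k)%N = jk) (f2 : (jk + i)%N = n)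
    (g1 : (k + i)%N = ki) (g2 : (ki + j)%N = n) x y z,
    sd_br e2 (sd_br e1 x y) z + sd_br f2 (sd_br f1 y z) x
      + sd_br g2 (sd_br g1 z x) y = 0.
Proof.
move=> i j k ij jk ki n e1 e2 f1 f2 g1 g2 x y z.
have e1' := etrans (addnC j i) e1; have e2' := etrans (addnC k ij) e2.
have f1' := etrans (addnC k j) f1; have f2' := etrans (addnC i jk) f2.
have g1' := etrans (addnC i k) g1; have g2' := etrans (addnC j ki) g2.
apply/eqP; rewrite -pair_eqE; apply/andP; split; apply/eqP; last exact: br_jacobi.
change ((sd_br e2 (sd_br e1 x y) z).1 + (sd_br f2 (sd_br f1 y z) x).1
      + (sd_br g2 (sd_br g1 z x) y).1 = 0).
rewrite (sd_br_jacobi_term e1 e2 f1 f2 g1 g2 e1' e2' f1' f2' g1' g2').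
rewrite (sd_br_jacobi_term f1 f2 g1 g2 e1 e2 f1' f2' g1' g2' e1' e2').
rewrite (sd_br_jacobi_term g1 g2 e1 e2 f1 f2 g1' g2' e1' e2' f1' f2').
have sum3 (V : zmodType) (b b' b'' c c' c'' : V) :
    (b + c) + (b' + c') + (b'' + c'') = (b + b' + b'') + (c + c' + c'').
  by rewrite !addrA (ACl (1*3*5*2*4*6)).
have tele (V : zmodType) (b b' b'' : V) :
    (b - b'') + (b' - b) + (b'' - b') = 0.
  by rewrite !addrA (ACl (1*4*3*6*5*2)) /= subrr add0r subrr add0r subrr.
by do 4!rewrite sum3 tele addr0; rewrite br_jacobi.
Qed.

Definition glie_sdprod : glie :=
  GLie sd_brDl sd_brDr sd_brxx sd_br_anti sd_br_jacobi.

End SemiDirect.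
End LieRings.

Section AdjointIdentities.
Local Open Scope ring_scope.
Variable L : glie.

Lemma br_der i j k ij ik jk n
    (ejk : (j + k)%N = jk) (e : (i + jk)%N = n)
    (eij : (i + j)%N = ij) (f : (ij + k)%N = n)
    (eik : (i + k)%N = ik) (g : (j + ik)%N = n) (m : L i) (x : L j) (y : L k) :
  br e m (br ejk x y) = br f (br eij m x) y + br g x (br eik m y).
Proof.
have e' := etrans (addnC jk i) e; have g' := etrans (addnC ik j) g.
have eik' := etrans (addnC k i) eik.
rewrite (br_anti e e') (br_anti g g') (br_anti eik eik') brNl opprK.
by apply/esym/eqP; rewrite -addr_eq0 addrAC br_jacobi.
Qed.

Lemma br_br i j k ij jk ik n
    (eij : (i + j)%N = ij) (e : (ij + k)%N = n)
    (ejk : (j + k)%N = jk) (f : (i + jk)%N = n)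
    (eik : (i + k)%N = ik) (g : (j + ik)%N = n) (m : L i) (m' : L j) (x : L k) :
  br e (br eij m m') x = br f m (br ejk m' x) - br g m' (br eik m x).
Proof. by rewrite (br_der ejk f eij e eik g) addrK. Qed.

End AdjointIdentities.

Section Gr.
Variables (G : groupType) (F : nat -> set G).

Section Central.
Hypothesis cF : is_central F.

Lemma central_filt : is_filtration F. Proof. by case: cF. Qed.

Lemma gr_cmt_den i : cmt_subgroup (F i) (F i) `<=` F i.+1.
Proof.
apply/(cmt_subgroupP _ _ (filt_sub i.+1 central_filt)) => a b _.
exact: centralP.
Qed.

Definition gr_section i : ab_section G :=
  AbSection (filt_sub i central_filt) (filt_sub i.+1 central_filt)
            (filt_le central_filt (leqnSn i)) (@gr_cmt_den i).

Definition gr i : zmodType := ab_quot (gr_section i).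

Definition gr_cls i (x : G) : gr i := cls (gr_section i) x.

Local Open Scope ring_scope.

Lemma gr_num i (u : gr i) : F i (rep u). Proof. exact: rep_num u. Qed.

Lemma gr_repK i (u : gr i) : gr_cls i (rep u) = u. Proof. exact: repK. Qed.

Lemma gr_clsM i x y : F i x -> F i y ->
  gr_cls i (x * y)%g = gr_cls i x + gr_cls i y.
Proof. by move=> Fx Fy; apply: clsM. Qed.

Lemma gr_cls0 i x : F i.+1 x -> gr_cls i x = 0.
Proof. by move=> Fx; apply: cls_den. Qed.

Lemma gr_cls_rep i x : F i x -> F i.+1 (rep (gr_cls i x) / x)%g.
Proof. by move=> Fx; apply: (@cls_rep _ (gr_section i)). Qed.

Lemma gr_cls_eq i x y : F i x -> F i y -> F i.+1 (x / y)%g ->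
  gr_cls i x = gr_cls i y.
Proof. by move=> Fx Fy h; apply/(@clsP _ (gr_section i)). Qed.

Lemma filt_conj i x y : F i y -> F i (x * y * x^-1)%g.
Proof.
move=> Fy; have := centralP x cF Fy; move/(filt_le central_filt (leqnSn i)).
move=> h; have := subgroupM (filt_sub i central_filt) h Fy.
by rewrite /cmt mulgVK.
Qed.

Lemma gr_conj i x y : F i y -> gr_cls i (x * y * x^-1)%g = gr_cls i y.
Proof.
by move=> Fy; apply: gr_cls_eq => //; [apply: filt_conj|apply: centralP].
Qed.

(* the q-power operation, well defined when F is of q-torsion: see gr_powE *)
Definition gr_pow (q i : nat) (u : gr i) : gr i.+1 := gr_cls i.+1 (rep u ^+ q)%g.

End Central.

Lemma gr_powE (cF : is_central F) q i x : is_qtorsion q F -> F i x ->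
  gr_pow q (gr_cls cF i x) = gr_cls cF i.+1 (x ^+ q)%g.
Proof.
move=> tF Fx; have fF := central_filt cF.
have sF n := filt_sub n fF.
have Fy := gr_num (gr_cls cF i x); have := gr_cls_rep cF Fx.
rewrite /gr_pow; move: (rep _) Fy => y Fy h.
apply: gr_cls_eq; try exact: qtorsionP.
rewrite -[y](mulgVK x); move: (y / x)%g h => d Fd {y Fy}.
suff h n : F i.+2 ((d * x) ^+ n / (d ^+ n * x ^+ n))%g.
  have -> : ((d * x) ^+ q / x ^+ q =
             ((d * x) ^+ q / (d ^+ q * x ^+ q)) * d ^+ q)%g.
    by rewrite invgM mulgA mulgVK.
  by apply: subgroupM => //; apply: qtorsionP.
elim: n => [|n IH]; first by rewrite !expg0 !mul1g invg1; apply: subgroup1.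
set z := ((d * x) ^+ n)%g in IH *.
have -> : ((d * x) ^+ n.+1 / (d ^+ n.+1 * x ^+ n.+1) =
  (d * x) * (z / (d ^+ n * x ^+ n)) * (d * x)^-1 *
  (d * (cmt x (d ^+ n)) * d^-1))%g.
  by rewrite expgS -/z /cmt !expgS !invgM !mulgA !mulgVK.
apply: subgroupM => //; apply: filt_conj => //.
by apply: centralP => //; apply: subgroupX.
Qed.

Section NSeries.
Hypothesis nF : is_nseries F.
Let cF := nseries_central nF.
Let fF := central_filt cF.
Local Open Scope ring_scope.

Definition gr_br i j k (e : (i + j)%N = k) (u : gr cF i) (v : gr cF j) : gr cF k :=
  gr_cls cF k (cmt (rep u) (rep v)).

Let cmt_in i j k x y : (i + j)%N = k -> F i x -> F j y -> F k (cmt x y).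
Proof. by move=> <-; apply: nseriesP. Qed.

Lemma cmtMl (x x' y : G) :
  (cmt (x * x') y = (x * cmt x' y * x^-1) * cmt x y)%g.
Proof. by rewrite /cmt !invgM !mulgA !mulgVK. Qed.

Lemma cmtMr (x y y' : G) :
  (cmt x (y * y') = cmt x y * (y * cmt x y' * y^-1))%g.
Proof. by rewrite /cmt !invgM !mulgA !mulgVK. Qed.

Lemma gr_cmtMl i j k (e : (i + j)%N = k) x x' y : F i x -> F i x' -> F j y ->
  gr_cls cF k (cmt (x * x') y)%g = gr_cls cF k (cmt x y) + gr_cls cF k (cmt x' y).
Proof.
move=> Fx Fx' Fy; have h := cmt_in e Fx Fy; have h' := cmt_in e Fx' Fy.
by rewrite cmtMl gr_clsM ?gr_conj //; [rewrite addrC|apply: filt_conj].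
Qed.

Lemma gr_cmtMr i j k (e : (i + j)%N = k) x y y' : F i x -> F j y -> F j y' ->
  gr_cls cF k (cmt x (y * y'))%g = gr_cls cF k (cmt x y) + gr_cls cF k (cmt x y').
Proof.
move=> Fx Fy Fy'; have h := cmt_in e Fx Fy; have h' := cmt_in e Fx Fy'.
by rewrite cmtMr gr_clsM ?gr_conj //; apply: filt_conj.
Qed.

Lemma gr_brE i j k (e : (i + j)%N = k) x y : F i x -> F j y ->
  gr_br e (gr_cls cF i x) (gr_cls cF j y) = gr_cls cF k (cmt x y).
Proof.
move=> Fx Fy; rewrite /gr_br.
have Fx' := gr_num (gr_cls cF i x); have hx := gr_cls_rep cF Fx.
have Fy' := gr_num (gr_cls cF j y); have hy := gr_cls_rep cF Fy.
move: (rep (gr_cls cF i x)) (rep (gr_cls cF j y)) Fx' Fy' hx hy => x' y' Fx' Fy' hx hy.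
rewrite -[x'](mulgVK x) (gr_cmtMl e) //; last first.
  exact: filt_le (leqnSn i) _ hx.
rewrite gr_cls0 ?add0r; last by apply: cmt_in hx Fy'; rewrite addSn e.
rewrite -[y'](mulgVK y) (gr_cmtMr e) //; last first.
  exact: filt_le (leqnSn j) _ hy.
by rewrite gr_cls0 ?add0r //; apply: cmt_in Fx hy; rewrite addnS e.
Qed.

Lemma gr_brDl i j k (e : (i + j)%N = k) u u' v :
  gr_br e (u + u') v = gr_br e u v + gr_br e u' v.
Proof.
rewrite -(gr_repK u) -(gr_repK u') -(gr_repK v) -gr_clsM ?gr_brE;
  try exact: gr_num; first exact: (gr_cmtMl e (gr_num _) (gr_num _) (gr_num _)).
by apply: subgroupM; [exact: filt_sub|exact: gr_num|exact: gr_num].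
Qed.

Lemma gr_brDr i j k (e : (i + j)%N = k) u v v' :
  gr_br e u (v + v') = gr_br e u v + gr_br e u v'.
Proof.
rewrite -(gr_repK u) -(gr_repK v') -(gr_repK v) -gr_clsM ?gr_brE;
  try exact: gr_num; first exact: (gr_cmtMr e (gr_num _) (gr_num _) (gr_num _)).
by apply: subgroupM; [exact: filt_sub|exact: gr_num|exact: gr_num].
Qed.

Lemma gr_brxx i k (e : (i + i)%N = k) u : gr_br e u u = 0.
Proof.
rewrite /gr_br /cmt mulgK mulgV gr_cls0 //.
by apply: subgroup1; exact: filt_sub.
Qed.

Lemma gr_br_anti i j k (e : (i + j)%N = k) (e' : (j + i)%N = k) u v :
  gr_br e u v = - gr_br e' v u.
Proof.
have Fu := gr_num u; have Fv := gr_num v.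
have h := cmt_in e Fu Fv; have h' := cmt_in e' Fv Fu.
apply/eqP; rewrite -addr_eq0 /gr_br -gr_clsM //.
rewrite /cmt !mulgA !mulgVK mulgK mulgV gr_cls0 //.
by apply: subgroup1; exact: filt_sub.
Qed.

Lemma hall_witt (x y z : G) :
  (cmt (cmt x y) (y * z * y^-1) * cmt (cmt y z) (z * x * z^-1) *
   cmt (cmt z x) (x * y * x^-1) = 1)%g.
Proof. by rewrite /cmt !invgM !invgK !mulgA; do 9!rewrite ?mulgK ?mulgVK; rewrite mulgV. Qed.

Lemma gr_br_jacobi i j k ij jk ki n
    (e1 : (i + j)%N = ij) (e2 : (ij + k)%N = n)
    (f1 : (j + k)%N = jk) (f2 : (jk + i)%N = n)
    (g1 : (k + i)%N = ki) (g2 : (ki + j)%N = n) x y z :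
  gr_br e2 (gr_br e1 x y) z + gr_br f2 (gr_br f1 y z) x
    + gr_br g2 (gr_br g1 z x) y = 0.
Proof.
rewrite -(gr_repK x) -(gr_repK y) -(gr_repK z).
move: (rep x) (rep y) (rep z) (gr_num x) (gr_num y) (gr_num z).
move=> {}x {}y {}z Fx Fy Fz.
rewrite -[gr_cls _ k z in X in X + _ + _](gr_conj cF y Fz).
rewrite -[gr_cls _ i x in X in _ + X + _](gr_conj cF z Fx).
rewrite -[gr_cls _ j y in X in _ + _ + X](gr_conj cF x Fy).
have Fz' := filt_conj cF y Fz; have Fx' := filt_conj cF z Fx.
have Fy' := filt_conj cF x Fy.
have h1 := cmt_in e1 Fx Fy; have h2 := cmt_in f1 Fy Fz.
have h3 := cmt_in g1 Fz Fx.
have k1 := cmt_in e2 h1 Fz'; have k2 := cmt_in f2 h2 Fx'.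
have k3 := cmt_in g2 h3 Fy'; have sF := filt_sub n fF.
rewrite !gr_brE // -!gr_clsM //; last exact: subgroupM.
by rewrite hall_witt gr_cls0 //; apply: subgroup1; exact: filt_sub.
Qed.

Definition gr_lie : glie :=
  GLie gr_brDl gr_brDr gr_brxx gr_br_anti gr_br_jacobi.

End NSeries.
End Gr.

(* Bijectivity of each [a k] follows from aact1 and aactM. *)
Record aut_action (K H : groupType) := AutAction {
  aact :> K -> H -> H;
  aact1 : forall h, aact 1 h = h;
  aactM : forall k k' h, aact (k * k') h = aact k (aact k' h);
  aact_mul : forall k h h', aact k (h * h') = aact k h * aact k h' }.

(* The underlying set of H x| K, with (h, k)(h', k') = (h (k . h'), k k'). *)
Definition sdp (K H : groupType) (a : aut_action K H) : Type := (H * K)%type.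

Section SemiDirectProduct.
Variables (K H : groupType) (a : aut_action K H).

Lemma aact_one k : a k 1 = 1.
Proof. by apply: (@mulgI _ (a k 1)); rewrite -aact_mul !mulg1. Qed.

Lemma aactV k h : a k h^-1 = (a k h)^-1.
Proof. by apply: (@mulgI _ (a k h)); rewrite -aact_mul !mulgV aact_one. Qed.

Local Notation sdp := (sdp a).

HB.instance Definition _ := Choice.copy sdp (H * K)%type.

Definition sdp_one : sdp := (1, 1).
Definition sdp_inv (x : sdp) : sdp := (a x.2^-1 x.1^-1, x.2^-1).
Definition sdp_mul (x y : sdp) : sdp := (x.1 * a x.2 y.1, x.2 * y.2).

Lemma sdp_mulA : associative sdp_mul.
Proof.
by move=> x y z; rewrite /sdp_mul /= !mulgA aact_mul aactM !mulgA.
Qed.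

Lemma sdp_mul1 : left_id sdp_one sdp_mul.
Proof. by move=> [h k]; rewrite /sdp_mul /= !mul1g aact1. Qed.

Lemma sdp_mulr1 : right_id sdp_one sdp_mul.
Proof. by move=> [h k]; rewrite /sdp_mul /= aact_one !mulg1. Qed.

Lemma sdp_mulV : left_inverse sdp_one sdp_inv sdp_mul.
Proof. by move=> [h k]; rewrite /sdp_mul /= -aact_mul !mulVg aact_one. Qed.

Lemma sdp_mulVr : right_inverse sdp_one sdp_inv sdp_mul.
Proof. by move=> [h k]; rewrite /sdp_mul /= -aactM !mulgV aact1 mulgV. Qed.

HB.instance Definition _ := isGroup.Build sdp
  sdp_mulA sdp_mul1 sdp_mulr1 sdp_mulV sdp_mulVr.

Definition inH (h : H) : sdp := (h, 1).
Definition inK (k : K) : sdp := (1, k).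

Lemma sdpM (x y : sdp) : x * y = (x.1 * a x.2 y.1, x.2 * y.2) :> sdp.
Proof. by []. Qed.

Lemma sdpV (x : sdp) : x^-1 = (a x.2^-1 x.1^-1, x.2^-1) :> sdp.
Proof. by []. Qed.

Lemma sdp1 : 1 = (1, 1) :> sdp. Proof. by []. Qed.

Definition sd_set (A : set H) (B : set K) : set sdp :=
  [set x | A x.1 /\ B x.2].

(* gamma^K_n(H), computed in the semidirect product and read back in H *)
Definition rel_lcs (n : nat) : set H :=
  inH @^-1` iter n.-1 (cmt_subgroup setT) (range inH).

Definition sd_compat (FH : nat -> set H) (FK : nat -> set K) :=
  forall i j, cmt_subgroup (inK @` FK j) (inH @` FH i) `<=` inH @` FH (i + j)%N.

Definition sd_filt (FH : nat -> set H) (FK : nat -> set K) : nat -> set sdp :=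
  fun i => sd_set (FH i) (FK i).

Lemma cmt_inKH k h : cmt (inK k) (inH h) = inH (a k h / h).
Proof.
rewrite /cmt !sdpM !sdpV /inH /inK /=.
by rewrite !invg1 !aact_one !mul1g !mulg1 mulgV !aact1.
Qed.

Lemma cmt_inH h h' : cmt (inH h) (inH h') = inH (cmt h h').
Proof. by rewrite /cmt !sdpM !sdpV /inH /= !invg1 !mulg1 !aact1. Qed.

Lemma cmt_inK k k' : cmt (inK k) (inK k') = inK (cmt k k').
Proof. by rewrite /cmt !sdpM !sdpV /inK /= !invg1 !aact_one !mulg1. Qed.

Section NSeriesProduct.
Variables (FH : nat -> set H) (FK : nat -> set K).
Hypotheses (nH : is_nseries FH) (nK : is_nseries FK).
Hypothesis hc : sd_compat FH FK.

Let cH := nseries_central nH.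
Let cK := nseries_central nK.
Let fH := central_filt cH.
Let fK := central_filt cK.
Let sH i := filt_sub i fH.
Let sK i := filt_sub i fK.

Lemma sd_compatP i j k h : FK j k -> FH i h -> FH (i + j)%N (a k h / h).
Proof.
move=> Fk Fh.
have : cmt_subgroup (inK @` FK j) (inH @` FH i) (inH (a k h / h)).
  rewrite -cmt_inKH; apply: sub_gen; exists (inK k); first by exists k.
  by exists (inH h) => //; exists h.
by move=> /hc [h' Fh' [<-]].
Qed.

Lemma sd_compat1 i k h : FH i h -> FH i.+1 (a k h / h).
Proof.
by move=> Fh; rewrite -addn1; apply: sd_compatP => //; case: fK => _ ->.
Qed.

Lemma sd_stable i k h : FH i h -> FH i (a k h).
Proof.
move=> Fh; rewrite -(mulgVK h (a k h)); apply: subgroupM => //.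
by apply: (filt_le fH (leqnSn i)); apply: sd_compat1.
Qed.

Lemma sd_filt_subgroup i : is_subgroup (sd_filt FH FK i).
Proof.
split=> [|x y [h1 k1] [h2 k2]]; first by split; apply: subgroup1.
rewrite sdpM sdpV; split=> /=; last by apply: (sK i).2.
apply: subgroupM => //; apply: sd_stable; apply: sd_stable.
exact: subgroupV.
Qed.

Lemma sd_filt_filtration : is_filtration (sd_filt FH FK).
Proof.
case: (fH) (fK) => H0 H1 _ dH [K0 K1 _ dK]; split=> [|||i x [h k]].
- by apply/seteqP; split=> // x _; split; rewrite ?H0 ?K0.
- by apply/seteqP; split=> // x _; split; rewrite ?H1 ?K1.
- exact: sd_filt_subgroup.
- by split; [apply: dH|apply: dK].
Qed.

Let eqH n (x y : H) := FH n (x / y).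

Let eqH_refl n x : eqH n x x.
Proof. by rewrite /eqH mulgV; apply: subgroup1. Qed.

Let eqH_mul n x x' y y' : eqH n x x' -> eqH n y y' -> eqH n (x * y) (x' * y').
Proof.
rewrite /eqH => hx hy.
have -> : x * y / (x' * y') = x * (y / y') * x^-1 * (x / x').
  by rewrite invgM !mulgA mulgVK.
by apply: subgroupM => //; apply: filt_conj.
Qed.

Let eqH_in n x y : eqH n x y -> FH n y -> FH n x.
Proof. by move=> h Fy; rewrite -(mulgVK y x); apply: subgroupM. Qed.

Lemma sd_nseries : is_nseries (sd_filt FH FK).
Proof.
split; first exact: sd_filt_filtration.
move=> i j; apply/(cmt_subgroupP _ _ (sd_filt_subgroup _)).
move=> [h k] [h' k'] [/= Fh Fk] [/= Fh' Fk'].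
have -> : cmt ((h, k) : sdp) (h', k') =
    (h * a k h' * a (k * k' * k^-1) h^-1 * a (cmt k k') h'^-1, cmt k k').
  rewrite /cmt !sdpM !sdpV /=; congr (_, _).
  by rewrite -!aactM.
split=> /=; last exact: nseriesP.
have Fhh := nseriesP nH Fh Fh'.
apply: eqH_in Fhh; rewrite /cmt.
apply: (eqH_mul (eqH_mul (eqH_mul (eqH_refl _ _) _) _) _).
- by rewrite /eqH addnC; apply: sd_compatP.
- apply: sd_compatP; first exact: filt_conj.
  exact: subgroupV.
- have h1 : FK i (cmt k k').
    have := nseriesP nK Fk Fk'; apply: filt_le => //; exact: leq_addr.
  by rewrite /eqH addnC; apply: sd_compatP => //; apply: subgroupV.
Qed.

Lemma sd_qtorsion q :
  is_qtorsion q FH -> is_qtorsion q FK -> is_qtorsion q (sd_filt FH FK).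
Proof.
move=> tH tK i; apply/(pow_subgroupP _ _ (sd_filt_subgroup _)).
move=> [h k] [/= Fh Fk].
suff /(_ q) [e1 e2] n : eqH i.+1 (((h, k) : sdp) ^+ n).1 (h ^+ n) /\
    (((h, k) : sdp) ^+ n).2 = k ^+ n.
  split; last by rewrite e2; apply: qtorsionP.
  by apply: eqH_in e1 _; apply: qtorsionP.
elim: n => [|n]; first by split; first exact: eqH_refl.
rewrite !expgS; case: (((h, k) : sdp) ^+ n) => x y /= [IH1 ->]; split=> //.
apply: eqH_mul; first exact: eqH_refl.
have Fx : FH i x.
  apply: eqH_in (subgroupX n (sH i) Fh).
  exact: (filt_le fH (leqnSn i)).
rewrite /eqH -(divgKA x); apply: subgroupM => //.
exact: sd_compat1.
Qed.

Local Open Scope ring_scope.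

Let nS := sd_nseries.
Let cS := nseries_central nS.
Local Notation LS := (gr_lie nS).
Local Notation LH := (gr_lie nH).
Local Notation LK := (gr_lie nK).

(* gr(K) acts on gr(H) through the class of (k . h) h^-1 *)
Definition gr_act_fun i j k (e : (i + j)%N = k) (u : LK i) (v : LH j) : LH k :=
  gr_cls cH k (a (rep u) (rep v) / rep v)%g.

Definition gr_inH i (u : LH i) : LS i := gr_cls cS i (inH (rep u)).
Definition gr_inK i (u : LK i) : LS i := gr_cls cS i (inK (rep u)).

Let FS_inH i h : FH i h -> sd_filt FH FK i (inH h).
Proof. by split => //=; apply: subgroup1. Qed.

Let FS_inK i k : FK i k -> sd_filt FH FK i (inK k).
Proof. by split => //=; apply: subgroup1. Qed.

Let inHM (h h' : H) : inH (h * h')%g = (inH h * inH h')%g.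
Proof. by rewrite sdpM /inH /= aact1 mulg1. Qed.

Let inKM (k k' : K) : inK (k * k')%g = (inK k * inK k')%g.
Proof. by rewrite sdpM /inK /= aact_one mulg1. Qed.

Let inHV (h : H) : inH h^-1%g = ((inH h)^-1)%g.
Proof. by rewrite sdpV /inH /= invg1 aact1. Qed.

Let inKV (k : K) : inK k^-1%g = ((inK k)^-1)%g.
Proof. by rewrite sdpV /inK /= invg1 aact_one. Qed.

Lemma gr_inH_cls i h : FH i h -> gr_inH (gr_cls cH i h) = gr_cls cS i (inH h).
Proof.
move=> Fh; have Fr := gr_num (gr_cls cH i h).
apply: gr_cls_eq; try exact: FS_inH.
by rewrite -inHV -inHM; apply: FS_inH; apply: gr_cls_rep.
Qed.

Lemma gr_inK_cls i k : FK i k -> gr_inK (gr_cls cK i k) = gr_cls cS i (inK k).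
Proof.
move=> Fk; have Fr := gr_num (gr_cls cK i k).
apply: gr_cls_eq; try exact: FS_inK.
by rewrite -inKV -inKM; apply: FS_inK; apply: gr_cls_rep.
Qed.

Lemma gr_inHD i (u v : LH i) : gr_inH (u + v) = gr_inH u + gr_inH v.
Proof.
have Fu := gr_num u; have Fv := gr_num v.
rewrite -{1}(gr_repK u) -{1}(gr_repK v) -gr_clsM // gr_inH_cls.
  by rewrite inHM gr_clsM //; apply: FS_inH.
exact: subgroupM.
Qed.

Lemma gr_inKD i (u v : LK i) : gr_inK (u + v) = gr_inK u + gr_inK v.
Proof.
have Fu := gr_num u; have Fv := gr_num v.
rewrite -{1}(gr_repK u) -{1}(gr_repK v) -gr_clsM // gr_inK_cls.
  by rewrite inKM gr_clsM //; apply: FS_inK.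
exact: subgroupM.
Qed.

Lemma gr_inH_br i j k (e : (i + j)%N = k) (u : LH i) (v : LH j) :
  gr_inH (br e u v) = br e (gr_inH u) (gr_inH v).
Proof.
have Fu := gr_num u; have Fv := gr_num v.
rewrite /= gr_brE; try exact: FS_inH.
rewrite cmt_inH gr_inH_cls //.
by rewrite -e; apply: nseriesP.
Qed.

Lemma gr_inK_br i j k (e : (i + j)%N = k) (u : LK i) (v : LK j) :
  gr_inK (br e u v) = br e (gr_inK u) (gr_inK v).
Proof.
have Fu := gr_num u; have Fv := gr_num v.
rewrite /= gr_brE; try exact: FS_inK.
rewrite cmt_inK gr_inK_cls //.
by rewrite -e; apply: nseriesP.
Qed.

Lemma gr_inH_act i j k (e : (i + j)%N = k) (u : LK i) (v : LH j) :
  gr_inH (gr_act_fun e u v) = br e (gr_inK u) (gr_inH v).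
Proof.
have Fu := gr_num u; have Fv := gr_num v.
rewrite /= gr_brE; [|exact: FS_inK|exact: FS_inH].
rewrite cmt_inKH gr_inH_cls //.
by rewrite -e addnC; apply: sd_compatP.
Qed.

(* the canonical map gr(H_* x| K_* ) -> gr(H_* ) x| gr(K_* ) and its inverse   *)
Definition gr_sd_split i (u : LS i) : (LH i * LK i)%type :=
  (gr_cls cH i (rep u).1, gr_cls cK i (rep u).2).

Definition gr_sd_join i (w : (LH i * LK i)%type) : LS i :=
  gr_cls cS i ((rep w.1, rep w.2) : sdp).

Lemma gr_sd_split_cls i h k : FH i h -> FK i k ->
  gr_sd_split (gr_cls cS i ((h, k) : sdp)) = (gr_cls cH i h, gr_cls cK i k).
Proof.
move=> Fh Fk; have := gr_cls_rep cS (conj Fh Fk : sd_filt FH FK i (h, k)).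
rewrite /gr_sd_split; case: (gr_num (gr_cls cS i ((h, k) : sdp))).
move: (rep _) => [h' k'] /= Fh' Fk'; rewrite sdpM sdpV => -[/= h1 k1].
congr (_, _); apply: gr_cls_eq => //.
rewrite -aactM in h1.
have := filt_conj cH h (sd_compat1 (k' / k)%g (subgroupV (sH i) Fh)).
rewrite invgK mulgA mulgK => /(subgroupV (sH _)) /(subgroupM (sH _) h1).
by rewrite invgM mulgA mulgK.
Qed.

Lemma gr_sd_joinE i (w : (LH i * LK i)%type) :
  gr_sd_join w = gr_inH w.1 + gr_inK w.2.
Proof.
have F1 := gr_num w.1; have F2 := gr_num w.2.
rewrite -gr_clsM; [|exact: FS_inH|exact: FS_inK].
by rewrite sdpM /inH /inK /= aact1 mul1g mulg1.
Qed.

Lemma gr_sd_splitK i : cancel (@gr_sd_split i) (@gr_sd_join i).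
Proof.
move=> u; have [/= F1 F2] := gr_num u.
rewrite gr_sd_joinE /gr_sd_split /= gr_inH_cls // gr_inK_cls //.
rewrite -gr_clsM; [|exact: FS_inH|exact: FS_inK].
by rewrite -[RHS]gr_repK sdpM /= aact1 mulg1 mul1g; case: (rep u).
Qed.

Lemma gr_sd_joinK i : cancel (@gr_sd_join i) (@gr_sd_split i).
Proof.
move=> w; rewrite /gr_sd_join gr_sd_split_cls; try exact: gr_num.
by rewrite !gr_repK; case: w.
Qed.

Lemma gr_inH_inj i : injective (@gr_inH i).
Proof.
move=> u v e.
have E w : gr_sd_split (gr_inH w) = (w, gr_cls cK i 1%g).
  rewrite /gr_inH gr_sd_split_cls ?gr_repK //; first exact: gr_num.
  exact: subgroup1.
by have := E u; rewrite e E => -[].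
Qed.

Lemma gr_inHN i (u : LH i) : gr_inH (- u) = - gr_inH u.
Proof.
apply/eqP; rewrite -addr_eq0 -gr_inHD addNr; apply/eqP.
by apply: (addrI (gr_inH (0 : LH i))); rewrite -gr_inHD !addr0.
Qed.

Lemma gr_actDl i j k (e : (i + j)%N = k) m m' x :
  gr_act_fun e (m + m') x = gr_act_fun e m x + gr_act_fun e m' x.
Proof.
by apply: gr_inH_inj; rewrite gr_inHD !gr_inH_act gr_inKD brDl.
Qed.

Lemma gr_actDr i j k (e : (i + j)%N = k) m x x' :
  gr_act_fun e m (x + x') = gr_act_fun e m x + gr_act_fun e m x'.
Proof.
by apply: gr_inH_inj; rewrite gr_inHD !gr_inH_act gr_inHD brDr.
Qed.

Lemma gr_act_der i j k ij ik jk n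
    (ejk : (j + k)%N = jk) (e : (i + jk)%N = n)
    (eij : (i + j)%N = ij) (f : (ij + k)%N = n)
    (eik : (i + k)%N = ik) (g : (j + ik)%N = n) (m : LK i) (x : LH j) (y : LH k) :
  gr_act_fun e m (br ejk x y) =
  br f (gr_act_fun eij m x) y + br g x (gr_act_fun eik m y).
Proof.
apply: gr_inH_inj; rewrite gr_inHD gr_inH_act !gr_inH_br !gr_inH_act.
exact: br_der.
Qed.

Lemma gr_act_br i j k ij jk ik n
    (eij : (i + j)%N = ij) (e : (ij + k)%N = n)
    (ejk : (j + k)%N = jk) (f : (i + jk)%N = n)
    (eik : (i + k)%N = ik) (g : (j + ik)%N = n) (m : LK i) (m' : LK j) (x : LH k) :
  gr_act_fun e (br eij m m') x =
  gr_act_fun f m (gr_act_fun ejk m' x) - gr_act_fun g m' (gr_act_fun eik m x).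
Proof.
apply: gr_inH_inj; rewrite gr_inHD gr_inHN !gr_inH_act gr_inK_br.
exact: br_br.
Qed.

Definition gr_action : glie_action LK LH :=
  GLieAction gr_actDl gr_actDr gr_act_der gr_act_br.

Local Notation LSD := (glie_sdprod gr_action).

Lemma gr_sd_split_iso :
  @is_glie_iso LS LSD (fun i => @gr_sd_split i).
Proof.
have joinD i (v w : LSD i) : gr_sd_join (v + w) = gr_sd_join v + gr_sd_join w.
  by rewrite !gr_sd_joinE gr_inHD gr_inKD addrACA.
split=> [i|i x y|i j k e x y].
- by exists (@gr_sd_join i); [exact: gr_sd_splitK|exact: gr_sd_joinK].
- apply: (can_inj (@gr_sd_joinK i)).
  by rewrite joinD !gr_sd_splitK.
- apply: (can_inj (@gr_sd_joinK k)); rewrite gr_sd_splitK.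
  rewrite -{1}(gr_sd_splitK x) -{1}(gr_sd_splitK y).
  move: (gr_sd_split x) (gr_sd_split y) => v w.
  rewrite !gr_sd_joinE !brDl !brDr.
  rewrite (br_anti e (etrans (addnC j i) e) (gr_inH v.1) (gr_inK w.2)) /=.
  by rewrite !gr_inHD gr_inHN gr_inH_br gr_inK_br !gr_inH_act /= !addrA
             [LHS](ACl (1*3*2*4)).
Qed.

(* the q-power operation of H_* x| K_*, transported to gr(H_* ) x| gr(K_* ) *)
Definition gr_sd_pow (q i : nat) (w : LSD i) : LSD i.+1 :=
  gr_sd_split (gr_pow q (gr_sd_join w)).

End NSeriesProduct.
End SemiDirectProduct.

(* The tensor product of abelian groups: the free abelian group on A * B       *)
(* modulo the bilinearity relations.                                           *)
Section Tensor.
Local Open Scope ring_scope.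
Variables A B : zmodType.

Definition tens_rel : set {freeg (A * B) / int} :=
  [set u | exists x x' y, u = << (x + x', y) >> - << (x, y) >> - << (x', y) >>]
  `|` [set u | exists x y y', u = << (x, y + y') >> - << (x, y) >> - << (x, y') >>].

Definition zmod_sub (V : zmodType) (S : set V) :=
  S 0 /\ forall u v, S u -> S v -> S (u - v).

Definition tens_ker : {pred {freeg (A * B) / int}} :=
  fun u => u \in smallest (@zmod_sub _) tens_rel.

Lemma tens_ker_zmod : zmod_closed tens_ker.
Proof.
split=> [|u v]; first by apply/mem_set => S [[S0 _] _].
move=> /set_mem hu /set_mem hv; apply/mem_set => S SP.
by apply: SP.1.2; [apply: hu|apply: hv].
Qed.

HB.instance Definition _ :=
  GRing.isZmodClosed.Build {freeg (A * B) / int} tens_ker tens_ker_zmod.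

Definition tensor : zmodType := Quotient.quot tens_ker.

Definition tens (x : A) (y : B) : tensor := \pi_(Quotient.quot tens_ker) << (x, y) >>.

End Tensor.

Section TensorMap.
Local Open Scope ring_scope.
Variables (A B A' B' : zmodType) (f : A -> A') (g : B -> B').

Definition tens_lift (u : {freeg (A * B) / int}) : {freeg (A' * B') / int} :=
  fglift (fun p : A * B => << (f p.1, g p.2) >> : {freeg (A' * B') / int}) u.

Definition tens_map (t : tensor A B) : tensor A' B' :=
  \pi_(Quotient.quot (@tens_ker A' B')) (tens_lift (repr t)).

Hypotheses (fD : {morph f : x y / x + y}) (gD : {morph g : x y / x + y}).

Lemma tens_mapE x y : tens_map (tens x y) = tens (f x) (g y).
Proof.
have liftB u v : tens_lift (u - v) = tens_lift u - tens_lift v.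
  exact: lift_is_additive.
have liftU z w : tens_lift << (z, w) >> = << (f z, g w) >>.
  by rewrite /tens_lift liftU scale1r.
rewrite /tens_map /tens; set u := << (x, y) >>.
rewrite -liftU -/u; apply/eqP; rewrite -Quotient.idealrBE -liftB.
have : repr (\pi_(Quotient.quot (@tens_ker A B)) u) - u \in @tens_ker A B.
  by rewrite Quotient.idealrBE reprK.
move=> /set_mem h; apply/mem_set => S SP.
apply: (h [set w | S (tens_lift w)]); split; first split=> /=.
- by rewrite -(subrr u) liftB subrr; apply: SP.1.1.
- by move=> v w Sv Sw; rewrite liftB; apply: SP.1.2.
- move=> w [[z [z' [v ->]]]|[z [v [v' ->]]]] /=; rewrite !liftB !liftU.
    by apply: SP.2; left; exists (f z), (f z'), (g v); rewrite fD.
  by apply: SP.2; right; exists (f z), (g v), (g v'); rewrite gD.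
Qed.

End TensorMap.

Section Abelianization.
Variable H : groupType.

Lemma setT_subgroup : is_subgroup [set: H]. Proof. by []. Qed.

Definition abel_section : ab_section H :=
  AbSection setT_subgroup (@gen_subgroup H _) (@subsetT _ _)
            (@subset_refl _ (cmt_subgroup [set: H] [set: H])).

Definition abel : zmodType := ab_quot abel_section.

Variables (K : groupType) (a : aut_action K H).

Definition abel_act (k : K) (u : abel) : abel := cls abel_section (a k (rep u)).

Lemma abel_actE k h :
  abel_act k (cls abel_section h) = cls abel_section (a k h).
Proof.
have := @cls_rep _ abel_section h Logic.I.
rewrite /abel_act; move: (rep _) => h' hh'; apply/clsP => //=.
rewrite -aactV -aact_mul.
apply: (@gen_min _ _ [set x | cmt_subgroup setT setT (a k x)]) hh'.
  split=> [|x y /= hx hy] /=; first by rewrite aact_one; apply: subgroup1; exact: gen_subgroup.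
  by rewrite aact_mul aactV; apply: (gen_subgroup _).2.
move=> _ [x _ [y _ <-]] /=; rewrite /cmt !aact_mul !aactV.
by apply: sub_gen; exists (a k x) => //; exists (a k y).
Qed.

Lemma abel_actD k : {morph abel_act k : u v / (u + v)%R}.
Proof.
move=> u v; rewrite -(repK u) -(repK v) -clsM // !abel_actE aact_mul.
exact: clsM.
Qed.

(* K acts trivially on H^ab (x) Z/q. For q >= 1, Z/q is the additive group     *)
(* 'I_q, written 'I_q.-1.+1 ('Z_q is not Z/q when q = 1).                      *)
Definition q_almost_direct (q : nat) :=
  forall (k : K) (t : tensor abel 'I_q.-1.+1), tens_map (abel_act k) id t = t.

End Abelianization.

(* Main.v *)
Require Import Defs.
From mathcomp Require Import all_boot all_order all_algebra.
From mathcomp Require Import all_classical.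
From mathcomp Require Import ring_quotient freeg.

Set Implicit Arguments.
Unset Strict Implicit.
Unset Printing Implicit Defensive.

Import GRing.Theory.

Local Open Scope classical_set_scope.
Local Open Scope group_scope.

(** Throughout, a group S acts on a group H, and everything is measured by the
displacements (s . h) h^-1. When H lies in S as a normal subgroup on which S
acts by conjugation, these are the commutators [s, h], so both the N-series
condition and the compatibility of two filtrations are bounds on
displacements.

Two constructions produce new q-torsion central filtrations from a q-torsion
central filtration N of H, and each is exploited through the minimality of the
filtrations gamma^(q).

- On the side of S ([johnson]): the elements of S that displace every N_j into
  N_(i+j). If S displaces every N_j into N_(j+1), they form a q-torsion central
  filtration, which therefore contains gamma^(q)(S). With G acting on itself
  by conjugation and N = gamma^(q)(G), this says that gamma^(q)(G) is an
  N-series, which is the main content of (1).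

- On the side of H ([displ_filt]): given sets A_i in S that displace H into
  N_(i+1) and satisfy [H, A_i] <= A_(i+1), the elements of N_j that each A_i
  displaces into N_(i+j). They form a q-torsion central filtration of H, so if
  N is minimal they are all of N, and bounds known on generators propagate to
  N.

For (2), let N be the q-torsion closure of the relative lower central series F
of H in S = H x| K. The second construction, with A the filtration [johnson] of
F, shows that S displaces N_j into N_(j+1). By minimality N_i is contained in
gamma_i^(q)(S), so the first construction makes N an N-series compatible with
gamma^(q)(K). Hence N x| gamma^(q)(K) is a q-torsion central filtration of S; it
contains gamma^(q)(S) by minimality, and is contained in it termwise.

For (3), triviality of the action on H^ab (x) Z/q means that K displaces H into
gamma_2^(q)(H), because H / gamma_2^(q)(H) is a quotient of H^ab killed by q. The
second construction with N = gamma^(q)(H) propagates this to all the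
gamma_j^(q)(H), so the relative lower central series lies in gamma^(q)(H).

The graded statement follows: gamma^(q)(H x| K) is then the termwise
semidirect product of gamma^(q)(H) and gamma^(q)(K), whose graded Lie ring splits
canonically. *)

(** * Central and q-torsion filtrations *)

Lemma cmtV (G : groupType) (x y : G) : cmt y x = (cmt x y)^-1.
Proof. by rewrite /cmt !invgM !invgK !mulgA. Qed.

Lemma centralI (G : groupType) (F : nat -> set G) :
    F 0%N = setT -> F 1%N = setT -> (forall i, is_subgroup (F i)) ->
    (forall i, F i.+1 `<=` F i) ->
    (forall i x y, F i y -> F i.+1 (cmt x y)) ->
  is_central F.
Proof.
move=> F0 F1 sF dF cF; split=> // i.
by apply/(cmt_subgroupP _ _ (sF _)) => x y _; apply: cF.
Qed.

Lemma qtorsionI (G : groupType) (F : nat -> set G) q :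
    (forall i, is_subgroup (F i)) ->
    (forall i x, F i x -> F i.+1 (x ^+ q)) ->
  is_qtorsion q F.
Proof.
by move=> sF tF i; apply/(pow_subgroupP _ _ (sF _)) => x; apply: tF.
Qed.

Lemma qlcs_min (G : groupType) (E : nat -> set G) q i :
  is_central E -> is_qtorsion q E -> qlcs G q i `<=` E i.
Proof. by move=> cE tE x; apply. Qed.

Lemma qtors_closure_min (G : groupType) (F E : nat -> set G) q i :
    is_central E -> is_qtorsion q E -> (forall j, F j `<=` E j) ->
  qtors_closure q F i `<=` E i.
Proof. by move=> cE tE FE x; apply. Qed.

Section CentralFiltration.
Variables (G : groupType) (F : nat -> set G).
Hypothesis cF : is_central F.

Lemma central_subgroup i : is_subgroup (F i).
Proof. exact: filt_sub (central_filt cF). Qed.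

Lemma centralS i x : F i.+1 x -> F i x.
Proof. exact: (filt_le (central_filt cF) (leqnSn i)). Qed.

Lemma central0 x : F 0%N x.
Proof. by case: cF => -[-> _ _ _] _. Qed.

Lemma central1 x : F 1%N x.
Proof. by case: cF => -[_ -> _ _] _. Qed.

Lemma centralPl i x y : F i x -> F i.+1 (cmt x y).
Proof.
move=> Fx; rewrite cmtV; apply: subgroupV; first exact: central_subgroup.
exact: centralP.
Qed.

End CentralFiltration.

(** * Displacements under a group action *)

Section Displacement.
Variables (S H : groupType) (a : aut_action S H).

Definition displ s h := a s h / h.

Lemma displK s h : displ s h * h = a s h.
Proof. exact: mulgVK. Qed.

Lemma aactK s h : a s^-1 (a s h) = h.
Proof. by rewrite -aactM mulVg aact1. Qed.

Lemma aactVK s h : a s (a s^-1 h) = h.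
Proof. by rewrite -aactM mulgV aact1. Qed.

(** For an automorphism group S of a free group with its lower central series,
this is the Andreadakis-Johnson filtration, whence the name. *)
Definition johnson (F : nat -> set H) (i : nat) : set S :=
  [set s | forall j h, F j h -> F (i + j)%N (displ s h)].

Section Johnson.
Variable F : nat -> set H.
Hypotheses (cF : is_central F).
Hypothesis aF : forall s j h, F j h -> F j.+1 (displ s h).

Let sF i := central_subgroup cF i.

Lemma act_stable s j h : F j h -> F j (a s h).
Proof.
move=> Fh; rewrite -displK; apply: subgroupM => //.
by apply: centralS => //; apply: aF.
Qed.

(** Write b . y = v y and g . y = w y with h = (b g) . y. Then both g b and b g
send y to a product of v, w and y, in opposite orders and up to displacements
of v by g and of w by b, which are one step deeper; the orders differ by
[v, w], which is also deeper since F is central. *)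
Lemma johnson_central : is_central (johnson F).
Proof.
apply: centralI.
- apply/seteqP; split=> // s _ j h Fh.
  by apply: centralS => //; apply: aF.
- by apply/seteqP; split=> // s _ j h Fh; apply: aF.
- move=> i; split=> [j h Fh|s t js jt j h Fh].
    by rewrite /displ aact1 mulgV; apply: subgroup1.
  have Fh' := act_stable t^-1 Fh.
  have -> : displ (s / t) h = displ s (a t^-1 h) / displ t (a t^-1 h).
    by rewrite /displ aactM aactVK invgM invgK !mulgA mulgVK.
  by apply: (sF _).2; [apply: js|apply: jt].
- by move=> i s js j h Fh; apply: centralS => //; apply: js.
move=> i g b jb j h Fh; rewrite addSn.
pose y := a (b * g)^-1 h; have Fy : F j y by apply: act_stable.
pose v := displ b y; pose w := displ g y.
have Fv : F (i + j)%N v by apply: jb.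
have Fw : F j.+1 w by apply: aF.
have -> : displ (cmt g b) h = displ g v * cmt v w * (displ b w)^-1.
  have eh : h = a b (w * y) by rewrite displK -aactM aactVK.
  have -> : displ (cmt g b) h = a g (v * y) / h.
    by rewrite displK /displ -aactM /y -aactM invgM !mulgA.
  have ev : a b y = v * y by rewrite displK.
  have ew : a g y = w * y by rewrite displK.
  rewrite eh; clearbody v w.
  rewrite !aact_mul -(displK g v) -(displK b w) ev ew.
  by rewrite /cmt !invgM !mulgA !mulgK.
apply: subgroupM => //; first apply: subgroupM => //.
- exact: aF.
- exact: centralPl.
- by apply: subgroupV => //; have := jb _ _ Fw; rewrite addnS.
Qed.

(** If s . h = v h, then s moves v by an element one step deeper, so s^n . h is
v^n h up to an element of depth i + j + 1; take n = q. *)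
Lemma johnson_qtorsion q : is_qtorsion q F -> is_qtorsion q (johnson F).
Proof.
move=> tF; apply: qtorsionI => [i|i s js j h Fh].
  exact: central_subgroup johnson_central i.
rewrite addSn; pose v := displ s h; have Fv : F (i + j)%N v by apply: js.
suff /(_ q) E n : F (i + j).+1 (displ (s ^+ n) h / v ^+ n).
  rewrite -(mulgVK (v ^+ q) (displ _ h)); apply: subgroupM => //.
  by apply: qtorsionP (central_filt cF) tF Fv.
elim: n => [|n IH].
  by rewrite !expg0 /displ aact1 invg1 mulg1 mulgV; apply: subgroup1.
set z := displ (s ^+ n) h / v ^+ n in IH.
have -> : displ (s ^+ n.+1) h / v ^+ n.+1 = a s z * displ s (v ^+ n).
  have e : a (s ^+ n) h = z * v ^+ n * h by rewrite mulgVK displK.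
  have ev : a s h = v * h by rewrite displK.
  rewrite {1}/displ expgS aactM e; clearbody z; clearbody v.
  by rewrite !aact_mul ev -(displK s (v ^+ n)) expgSr invgM !mulgA !mulgK.
apply: subgroupM => //; first exact: act_stable.
by apply: aF; apply: subgroupX.
Qed.

End Johnson.

(** * Elements of H with small displacements *)

Section DisplFilt.
(* iota picks, inside S, elements that act as the inner automorphisms of H. *)
Variable iota : H -> S.
Hypothesis iotaE : forall x h, a (iota x) h = x * h * x^-1.

Lemma act_cmt_iota x s h :
  a (cmt (iota x) s) h = (x / a s x) * h * (x / a s x)^-1.
Proof.
have iV y : a (iota x)^-1 y = x^-1 * y * x.
  by rewrite -[RHS](aactK (iota x)) iotaE !mulgA mulgV mul1g mulgK.
rewrite /cmt !aactM iV !aact_mul aactVK aactV !iotaE.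
by rewrite invgM invgK !mulgA !mulgVK.
Qed.

Variables (N : nat -> set H) (q : nat) (A : nat -> set S).
Hypotheses (cN : is_central N) (tN : is_qtorsion q N).
Hypothesis A_cmt : forall i x s, A i s -> A i.+1 (cmt (iota x) s).
Hypothesis A_displ : forall i s h, A i s -> N i.+1 (displ s h).

Definition displ_filt (j : nat) : set H :=
  [set y | N j y /\ forall i s, A i s -> N (i + j)%N (displ s y)].

Let sN i := central_subgroup cN i.

Lemma displ_filt_subgroup j : is_subgroup (displ_filt j).
Proof.
split=> [|x y [Nx ux] [Ny uy]].
  split=> [|i s As]; first exact: subgroup1.
  by rewrite /displ aact_one mulgV; apply: subgroup1.
split=> [|i s As]; first exact: (sN j).2.
have -> : displ s (x / y) =
    displ s x * ((x / y) * (displ s y)^-1 * (x / y)^-1).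
  by rewrite /displ aact_mul aactV !invgM !invgK !mulgA !mulgVK.
apply: subgroupM; [by []|exact: ux|].
by apply: filt_conj => //; apply: subgroupV => //; apply: uy.
Qed.

(** If s . y = v y and s . x = x u, then s . [x, y] = [x u, v y]. It differs from
[x, y] by a conjugate of [u, y] and by commutators of v, which lie in
N_(i+j+1) as N is central. The element [u, y] is the displacement of y by
[iota x^-1, s], which lies in A_(i+1). *)
Lemma displ_filt_central : is_central displ_filt.
Proof.
apply: centralI.
- apply/seteqP; split=> // x _; split=> [|i s As]; first exact: central0.
  by rewrite addn0; apply: centralS => //; apply: A_displ.
- apply/seteqP; split=> // x _; split=> [|i s As]; first exact: central1.
  by rewrite addn1; apply: A_displ.
- exact: displ_filt_subgroup.
- move=> j y [Ny uy]; split=> [|i s As]; first exact: centralS.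
  by apply: centralS => //; rewrite -addnS; apply: uy.
move=> j x y [Ny uy]; split=> [|i s As]; first exact: centralP.
pose v := displ s y; have Nv : N (i + j)%N v by apply: uy.
pose u := x^-1 * a s x; pose t := cmt (iota x^-1) s.
have tE : displ t y = cmt u y.
  by rewrite /displ /t act_cmt_iota aactV invgK.
have -> : displ s (cmt x y) =
    cmt (a s x) v * cmt v (cmt (a s x) y) * (x * cmt u y * x^-1).
  rewrite /displ {1}/cmt !aact_mul !aactV -(displK s y) -/v.
  have -> : a s x = x * u by rewrite mulVKg.
  by rewrite /cmt !invgM !invgK !mulgA !(mulgK, mulgVK).
rewrite addnS; apply: subgroupM => //; first apply: subgroupM => //.
- exact: centralP.
- exact: centralPl.
- apply: filt_conj => //; rewrite -tE -addSn; apply: uy.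
  exact: A_cmt.
Qed.

(** If s . y = v y, then s . y^n = (v y)^n, which agrees with v^n y^n up to an
element of N_(i+j+1), as v is central modulo it; take n = q. *)
Lemma displ_filt_qtorsion : is_qtorsion q displ_filt.
Proof.
apply: qtorsionI => [j|j y [Ny uy]]; first exact: displ_filt_subgroup.
split=> [|i s As]; first exact: qtorsionP (central_filt cN) tN Ny.
rewrite addnS; pose v := displ s y; have Nv : N (i + j)%N v by apply: uy.
suff /(_ q) E n : N (i + j).+1 (displ s (y ^+ n) / v ^+ n).
  rewrite -(mulgVK (v ^+ q) (displ _ _)); apply: subgroupM => //.
  exact: qtorsionP (central_filt cN) tN Nv.
elim: n => [|n IH].
  by rewrite !expg0 /displ aact_one invg1 !mulg1; apply: subgroup1.
set z := displ s (y ^+ n) / v ^+ n in IH.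
have -> : displ s (y ^+ n.+1) / v ^+ n.+1 =
    (v * y) * z * (v * y)^-1 * (v * cmt y (v ^+ n) * v^-1).
  have e : a s (y ^+ n) = z * v ^+ n * y ^+ n by rewrite mulgVK displK.
  rewrite {1}/displ !expgS aact_mul e -(displK s y) -/v.
  by rewrite /cmt !invgM !mulgA !mulgK !mulgVK.
apply: subgroupM => //; apply: filt_conj => //.
by apply: centralP => //; apply: subgroupX.
Qed.

End DisplFilt.
End Displacement.

(** * Functoriality *)

Section Homomorphisms.
Variables (G G' : groupType) (f : G -> G').
Hypothesis fM : {morph f : x y / x * y}.

Lemma morph_one : f 1 = 1.
Proof. by apply: (@mulgI _ (f 1)); rewrite -fM !mulg1. Qed.

Lemma morph_inv x : f x^-1 = (f x)^-1.
Proof. by apply: (@mulgI _ (f x)); rewrite -fM !mulgV morph_one. Qed.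

Lemma morph_exp x n : f (x ^+ n) = f x ^+ n.
Proof. by elim: n => [|n IH]; rewrite ?expg0 ?morph_one // !expgS fM IH. Qed.

Lemma morph_cmt x y : f (cmt x y) = cmt (f x) (f y).
Proof. by rewrite /cmt !fM !morph_inv. Qed.

Lemma image_subgroup (A : set G) : is_subgroup A -> is_subgroup (f @` A).
Proof.
move=> sA; split=> [|_ _ [x Ax <-] [y Ay <-]].
  by exists 1; [apply: subgroup1|apply: morph_one].
by exists (x / y); [apply: sA.2|rewrite fM morph_inv].
Qed.

Lemma preimage_subgroup (A : set G') :
  is_subgroup A -> is_subgroup (f @^-1` A).
Proof.
move=> sA; split=> [|x y Ax Ay] /=; first by rewrite morph_one; apply: subgroup1.
by rewrite fM morph_inv; apply: sA.2.
Qed.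

Variable (E : nat -> set G').
Hypothesis cE : is_central E.

Lemma preimage_central : is_central (fun i => f @^-1` E i).
Proof.
have sE i := central_subgroup cE i.
apply: centralI => [||i|i x|i x y Ey] /=.
- by apply/seteqP; split=> // x _; apply: central0.
- by apply/seteqP; split=> // x _; apply: central1.
- exact: preimage_subgroup.
- exact: centralS.
- by rewrite morph_cmt; apply: centralP.
Qed.

Lemma preimage_qtorsion q :
  is_qtorsion q E -> is_qtorsion q (fun i => f @^-1` E i).
Proof.
move=> tE; apply: qtorsionI => [i|i x Ex] /=.
  exact: central_subgroup preimage_central i.
by rewrite morph_exp; apply: qtorsionP (central_filt cE) tE Ex.
Qed.

End Homomorphisms.

Lemma qlcs_morph (G G' : groupType) (f : G -> G') q i x :
  {morph f : x y / x * y} -> qlcs G q i x -> qlcs G' q i (f x).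
Proof.
move=> fM; have [cE tE] := qlcs_qtorsion G' q; move: x.
by apply: (qlcs_min (preimage_central fM cE)); apply: preimage_qtorsion.
Qed.

(** * The q-torsion lower central series is an N-series *)

Section Conjugation.
Variable G : groupType.

Definition conj_fun (s h : G) : G := s * h * s^-1.

Fact conj_fun1 h : conj_fun 1 h = h.
Proof. by rewrite /conj_fun mul1g invg1 mulg1. Qed.

Fact conj_funM s t h : conj_fun (s * t) h = conj_fun s (conj_fun t h).
Proof. by rewrite /conj_fun invgM !mulgA. Qed.

Fact conj_fun_mul s h h' : conj_fun s (h * h') = conj_fun s h * conj_fun s h'.
Proof. by rewrite /conj_fun !mulgA mulgVK. Qed.

Definition conj_action : aut_action G G :=
  AutAction conj_fun1 conj_funM conj_fun_mul.

End Conjugation.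

(** For the conjugation action of G on itself the displacement of h by s is
[s, h], so being central is the hypothesis on displacements in
[johnson_central]; hence gamma_i^(q) is contained in the i-th term of
[johnson], which is the N-series condition. *)
Lemma qlcs_nseries (G : groupType) q : is_nseries (qlcs G q).
Proof.
have [cN tN] := qlcs_qtorsion G q.
have aN s j h : qlcs G q j h -> qlcs G q j.+1 (displ (conj_action G) s h).
  exact: centralP.
split=> [|i j]; first exact: central_filt.
apply/(cmt_subgroupP _ _ (central_subgroup cN _)) => x y Nx Ny.
have := qlcs_min (johnson_central cN aN) (johnson_qtorsion cN aN tN) Nx.
by apply.
Qed.

Lemma lcs_sub_central (G : groupType) (E : nat -> set G) i :
  is_central E -> lcs G i `<=` E i.
Proof.
move=> cE; case: i => [|i]; first by move=> x _; apply: central0.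
rewrite /lcs /=; elim: i => [|i IH]; first by move=> x _; apply: central1.
apply/(cmt_subgroupP _ _ (central_subgroup cE _)) => x y _ /IH.
exact: centralP.
Qed.

Lemma qtors_closure_lcs (G : groupType) q i :
  qtors_closure q (lcs G) i = qlcs G q i.
Proof.
apply/seteqP; split.
  have [cN tN] := qlcs_qtorsion G q.
  by apply: qtors_closure_min => // j; apply: lcs_sub_central.
by have [cN tN] := qtors_closure_qtorsion q (lcs G); apply: qlcs_min.
Qed.

(** * The relative lower central series of a semidirect product *)

Section SemiDirect.
Variables (K H : groupType) (a : aut_action K H).
Local Notation S := (sdp a).

(** The conjugation action of H x| K on its normal subgroup H; see [inH_conj]. *)
Definition sdp_conj (s : S) (h : H) : H := s.1 * a s.2 h * s.1^-1.

Lemma inH_inj : injective (inH a).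
Proof. by move=> h h' []. Qed.

Lemma inHM : {morph inH a : h h' / h * h'}.
Proof. by move=> h h'; rewrite sdpM /inH /= aact1 mulg1. Qed.

Lemma inKM : {morph inK a : k k' / k * k'}.
Proof. by move=> k k'; rewrite sdpM /inK /= aact_one mulg1. Qed.

Lemma inH_inK h k : (h, k) = inH a h * inK a k :> S.
Proof. by rewrite sdpM /= aact1 mulg1 mul1g. Qed.

Lemma inH_conj s h : inH a (sdp_conj s h) = s * inH a h * s^-1.
Proof.
rewrite !sdpM sdpV /inH /sdp_conj /=.
by rewrite mulg1 -aactM mulgV aact1.
Qed.

Fact sdp_conj1 h : sdp_conj 1 h = h.
Proof. by apply: inH_inj; rewrite inH_conj mul1g invg1 mulg1. Qed.

Fact sdp_conjM s t h : sdp_conj (s * t) h = sdp_conj s (sdp_conj t h).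
Proof. by apply: inH_inj; rewrite !inH_conj invgM !mulgA. Qed.

Fact sdp_conj_mul s h h' : sdp_conj s (h * h') = sdp_conj s h * sdp_conj s h'.
Proof. by apply: inH_inj; rewrite inHM !inH_conj inHM !mulgA mulgVK. Qed.

Definition sdp_action : aut_action S H :=
  AutAction sdp_conj1 sdp_conjM sdp_conj_mul.

Lemma inH_displ s h : inH a (displ sdp_action s h) = cmt s (inH a h).
Proof. by rewrite /displ inHM (morph_inv inHM) /= inH_conj. Qed.

Lemma displ_inH x h : displ sdp_action (inH a x) h = cmt x h.
Proof. by rewrite /displ /cmt /= /sdp_conj /= aact1. Qed.

Lemma sdp_action_inH x h : sdp_action (inH a x) h = x * h * x^-1.
Proof. by rewrite /= /sdp_conj /= aact1. Qed.

Lemma rel_lcs_displ s j h :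
  rel_lcs a j h -> rel_lcs a j.+1 (displ sdp_action s h).
Proof.
rewrite /rel_lcs /= inH_displ; case: j => [_|j] /=; last first.
  by move=> Fh; apply: sub_gen; exists s => //; exists (inH a h).
by rewrite -inH_displ; eexists.
Qed.

Lemma rel_lcs_min (E : nat -> set H) i : is_central E ->
    (forall s j h, E j h -> E j.+1 (displ sdp_action s h)) ->
  rel_lcs a i `<=` E i.
Proof.
move=> cE aE; case: i => [|i]; first by move=> h _; apply: central0.
suff sub : iter i (cmt_subgroup setT) (range (inH a)) `<=` inH a @` E i.+1.
  by move=> h /sub [x Ex /inH_inj <-].
elim: i => [|i IH] /=.
  by move=> _ [h _ <-]; exists h => //; apply: central1.
apply/cmt_subgroupP.
  exact: (image_subgroup inHM (central_subgroup cE _)).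
move=> s _ _ /IH [h Eh <-]; exists (displ sdp_action s h); first exact: aE.
exact: inH_displ.
Qed.

Lemma rel_lcs_central : is_central (rel_lcs a).
Proof.
apply: centralI => [||i|i|i x y Fy].
- by apply/seteqP; split=> // h _; exists h.
- by apply/seteqP; split=> // h _; exists h.
- apply: (preimage_subgroup inHM).
  case: i.-1 => [|n]; last exact: gen_subgroup.
  exact: (image_subgroup inHM (setT_subgroup H)).
- case: i => [|i] //; move=> h; rewrite /rel_lcs /preimage /=.
  move: (inH a h) => {h}; elim: i => [|i IH].
    move=> x; apply: gen_min x.
      exact: (image_subgroup inHM (setT_subgroup H)).
    move=> _ [s _ [_ [h _ <-] <-]].
    by exists (displ sdp_action s h) => //; apply: inH_displ.
  apply/(cmt_subgroupP _ _ (@gen_subgroup _ _)) => s y _ /IH Fy.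
  by apply: sub_gen; exists s => //; exists y.
- by rewrite -displ_inH; apply: rel_lcs_displ.
Qed.

Variable q : nat.

(** The relative lower central series F satisfies this bound by construction.
To pass to its closure N, all of the [johnson] filtration of F has to be
considered: [displ_filt_central] needs the sets A_i for every i, although the
conclusion only concerns A_1 = S. *)
Lemma closure_rel_lcs_displ s j h :
    qtors_closure q (rel_lcs a) j h ->
  qtors_closure q (rel_lcs a) j.+1 (displ sdp_action s h).
Proof.
have [cN tN] := qtors_closure_qtorsion q (rel_lcs a).
set N := qtors_closure q (rel_lcs a) in cN tN *.
pose A := johnson sdp_action (rel_lcs a).
have cA := johnson_central rel_lcs_central rel_lcs_displ.
have A_cmt i x s' : A i s' -> A i.+1 (cmt (inH a x) s') by apply: centralP.
have A_displ i s' x : A i s' -> N i.+1 (displ sdp_action s' x).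
  move=> As; apply: sub_qtors_closure; rewrite -addn1; apply: As.
  exact: central1 rel_lcs_central x.
have cU := displ_filt_central sdp_action_inH cN A_cmt A_displ.
have tU : is_qtorsion q (displ_filt sdp_action N A) by apply: displ_filt_qtorsion.
move=> Nh; have [_ Uh] : displ_filt sdp_action N A j h.
  apply: (qtors_closure_min cU tU _ Nh) => i x Fx; split.
    exact: sub_qtors_closure.
  by move=> i' s' As; apply: sub_qtors_closure; apply: As.
by apply: (Uh 1%N); apply: central1 cA s.
Qed.

Lemma qlcs_inH i h : qtors_closure q (rel_lcs a) i h -> qlcs S q i (inH a h).
Proof.
have [cE tE] := qlcs_qtorsion S q; move: h.
pose E j := inH a @^-1` qlcs S q j.
have cE' : is_central E := preimage_central (f := inH a) inHM cE.
apply: (@qtors_closure_min _ _ E) => //.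
  exact: (preimage_qtorsion (f := inH a) inHM cE tE).
move=> j; apply: rel_lcs_min => // s i' h.
by rewrite /E /= inH_displ; apply: centralP.
Qed.

(** H is contained in S compatibly with N and gamma^(q)(S), so that the
displacements of N_j by gamma_i^(q)(S) control [N_i, N_j]. *)
Lemma closure_rel_lcs_nseries : is_nseries (qtors_closure q (rel_lcs a)).
Proof.
have [cN tN] := qtors_closure_qtorsion q (rel_lcs a).
have aN := closure_rel_lcs_displ.
split=> [|i j]; first exact: central_filt.
apply/(cmt_subgroupP _ _ (central_subgroup cN _)) => x y /qlcs_inH Sx Ny.
rewrite -displ_inH.
have := qlcs_min (johnson_central cN aN) (johnson_qtorsion cN aN tN) Sx.
by apply.
Qed.

Lemma closure_rel_lcs_compat : sd_compat a (qtors_closure q (rel_lcs a)) (qlcs K q).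
Proof.
have [cN tN] := qtors_closure_qtorsion q (rel_lcs a).
have aN := closure_rel_lcs_displ; move=> i j.
apply/cmt_subgroupP => [|_ _ [k Kk <-] [h Nh <-]].
  exact: (image_subgroup inHM (central_subgroup cN _)).
exists (displ sdp_action (inK a k) h); last exact: inH_displ.
rewrite addnC; have Sk := qlcs_morph inKM Kk.
have := qlcs_min (johnson_central cN aN) (johnson_qtorsion cN aN tN) Sk.
by apply.
Qed.

Lemma qlcs_sdp i :
  qlcs S q i = sd_set (qtors_closure q (rel_lcs a) i) (qlcs K q i).
Proof.
have [_ tN] := qtors_closure_qtorsion q (rel_lcs a).
have [_ tK] := qlcs_qtorsion K q.
apply/seteqP; split; last first.
  move=> [h k] [/= Nh Kk]; rewrite inH_inK.
  apply: (subgroupM (central_subgroup (qlcs_qtorsion S q).1 i)).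
  - exact: qlcs_inH.
  - exact: qlcs_morph inKM Kk.
have nN := closure_rel_lcs_nseries; have nK := qlcs_nseries K q.
have hc := closure_rel_lcs_compat.
apply: (qlcs_min (nseries_central (sd_nseries nN nK hc))).
exact: sd_qtorsion.
Qed.

End SemiDirect.

(** * Tensoring with Z/q *)

Section TensorCyclic.
Local Open Scope ring_scope.
Variables (A V : zmodType) (q : nat) (f : A -> V).
Hypotheses (q_gt0 : (0 < q)%N) (fD : {morph f : x y / x + y}).
Hypothesis Vq : forall v : V, v *+ q = 0.

Lemma mulrn_modq (v : V) n : v *+ (n %% q.-1.+1) = v *+ n.
Proof.
rewrite prednK //.
by rewrite [in RHS](divn_eq n q) mulrnDr mulnC mulrnA Vq mul0rn add0r.
Qed.

(* V is regarded as a module over int, as the universal property of free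
   abelian groups requires. *)
Let g (p : A * 'I_q.-1.+1) : zmodule V := f p.1 *+ p.2.

(** Every additive map f from A to a group V killed by q factors through
A (x) Z/q as x (x) n |-> n f(x). Here inZp 1 is the generator of Z/q for every
q >= 1, including q = 1 where it is 0. *)
Lemma tens_one_eq (u v : A) :
    tens u (inZp 1 : 'I_q.-1.+1) = tens v (inZp 1 : 'I_q.-1.+1) -> f u = f v.
Proof.
move=> /eqP; rewrite /tens -Quotient.idealrBE => /set_mem.
have liftB x y : fglift g (x - y) = fglift g x - fglift g y.
  exact: lift_is_additive.
have liftU z w : fglift g << (z, w) >> = f z *+ w.
  by rewrite liftU scale1r.
move/(_ [set w | fglift g w = 0]) => h.
have /h : zmod_sub [set w | fglift g w = 0] /\
    @tens_rel A 'I_q.-1.+1 `<=` [set w | fglift g w = 0].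
  split; first split=> /=.
  - by rewrite -(subrr 0) liftB subrr.
  - by move=> x y gx gy; rewrite liftB gx gy subrr.
  move=> w [[x [x' [y ->]]]|[x [y [y' ->]]]] /=; rewrite !liftB !liftU.
    by rewrite fD mulrnDl addrAC addrK subrr.
  by rewrite /= mulrn_modq mulrnDr addrAC addrK subrr.
rewrite /= liftB !liftU /= !mulrn_modq !mulr1n => /eqP.
by rewrite subr_eq0 => /eqP.
Qed.

End TensorCyclic.

(** * q-almost direct products *)

Section AlmostDirect.
Variables (K H : groupType) (a : aut_action K H) (q : nat).
Hypotheses (q_gt0 : (0 < q)%N) (adq : q_almost_direct a q).

(** The projection of H onto H / gamma_2^(q)(H) factors through H^ab, and its
target is killed by q, so it identifies h and k . h as soon as they have the
same image in H^ab (x) Z/q. *)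
Lemma almost_direct_qlcs2 k h : qlcs H q 2 (a k h / h).
Proof.
have [cN tN] := qlcs_qtorsion H q.
pose f (u : abel H) : gr cN 1 := gr_cls cN 1 (rep u).
have fE x : f (cls (abel_section H) x) = gr_cls cN 1 x.
  apply: gr_cls_eq; try exact: central1.
  have := @cls_rep _ (abel_section H) x Logic.I.
  have := cN.2 1%N; case: (central_filt cN) => _ -> _ _.
  by apply.
have fD : {morph f : u v / (u + v)%R}.
  move=> u v; rewrite -(repK u) -(repK v) -clsM // !fE.
  by rewrite gr_clsM //; apply: central1.
have Vq (v : gr cN 1) : (v *+ q = 0)%R.
  have powE x n : gr_cls cN 1 (x ^+ n) = (gr_cls cN 1 x *+ n)%R.
    elim: n => [|n IH]; first by rewrite expg0 mulr0n.
    by rewrite expgS mulrS gr_clsM ?IH //; apply: central1.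
  rewrite -(gr_repK v) -powE gr_cls0 //.
  exact: qtorsionP (central_filt cN) tN (gr_num v).
have := adq k (tens (cls (abel_section H) h) (inZp 1)).
rewrite tens_mapE //; last exact: abel_actD.
move/(tens_one_eq q_gt0 fD Vq); rewrite abel_actE !fE.
by move/(@clsP _ (gr_section cN 1)); apply; apply: central1.
Qed.

(** Take for A_i all the elements that displace H into N_(i+1), where N is
gamma^(q)(H): the previous lemma says that A_1 is everything. *)
Lemma almost_direct_displ s j h :
  qlcs H q j h -> qlcs H q j.+1 (displ (sdp_action a) s h).
Proof.
have [cN tN] := qlcs_qtorsion H q; set N := qlcs H q in cN tN *.
have sN i := central_subgroup cN i.
pose A i := [set t | forall x, N i.+1 (displ (sdp_action a) t x)].
have A1 t : A 1%N t.
  move=> x; rewrite /displ /= /sdp_conj.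
  have -> : t.1 * a t.2 x * t.1^-1 / x = cmt t.1 (a t.2 x) * (a t.2 x / x).
    by rewrite /cmt !mulgA mulgVK.
  apply: (subgroupM (sN 2)); last exact: almost_direct_qlcs2.
  exact: (centralP _ cN (central1 cN _)).
have A_cmt i x t : A i t -> A i.+1 (cmt (inH a x) t).
  move=> At y; rewrite /displ (act_cmt_iota (sdp_action_inH a)).
  apply: (@centralPl _ _ cN i.+1); rewrite -invgF.
  by apply: (subgroupV (sN i.+1)); apply: At.
have A_displ i t x : A i t -> N i.+1 (displ (sdp_action a) t x) by apply.
have cU := displ_filt_central (sdp_action_inH a) cN A_cmt A_displ.
have tU : is_qtorsion q (displ_filt (sdp_action a) N A) by apply: displ_filt_qtorsion.
by move=> Nh; have [_ Uh] := qlcs_min cU tU Nh; apply: (Uh 1%N).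
Qed.

Lemma closure_rel_lcs_almost_direct i :
  qtors_closure q (rel_lcs a) i = qlcs H q i.
Proof.
apply/seteqP; split; last first.
  by have [cN tN] := qtors_closure_qtorsion q (rel_lcs a); apply: qlcs_min.
have [cN tN] := qlcs_qtorsion H q.
apply: qtors_closure_min => // j.
exact: rel_lcs_min cN almost_direct_displ.
Qed.

End AlmostDirect.

(** The filtration FS is kept as a variable so that the equality can be
substituted: the types of the graded pieces depend on it. *)
Lemma gr_sd_iso_of_eq (K H : groupType) (a : aut_action K H) (q : nat)
    (FS : nat -> set (sdp a)) (FH : nat -> set H) (FK : nat -> set K)
    (nS : is_nseries FS) (nH : is_nseries FH) (nK : is_nseries FK)
    (hc : sd_compat a FH FK) :
  FS = sd_filt FH FK ->
  exists phi : forall i, gr_lie nS i -> glie_sdprod (gr_action nH nK hc) i,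
    [/\ is_glie_iso phi,
        forall i (h : H) (k : K), FH i h -> FK i k ->
          phi i (gr_cls (nseries_central nS) i ((h, k) : sdp a)) =
          (gr_cls (nseries_central nH) i h, gr_cls (nseries_central nK) i k)
      & forall i (u : gr_lie nS i),
          phi i.+1 (gr_pow q u) = gr_sd_pow q (phi i u)].
Proof.
move=> eS; subst FS; rewrite (Prop_irrelevance nS (sd_nseries nH nK hc)).
exists (@gr_sd_split _ _ _ _ _ nH nK hc); split.
- exact: gr_sd_split_iso.
- by move=> i h k Fh Fk; apply: gr_sd_split_cls.
- by move=> i u; rewrite /gr_sd_pow gr_sd_splitK.
Qed.

Theorem theorem5p9 (q : nat) (hq : (1 <= q)%N) (G : groupType) :
  ((forall i, qlcs G q i = qtors_closure q (lcs G) i) /\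
   is_nseries (qlcs G q)) /\
  (forall (K H : groupType) (a : aut_action K H),
    [/\ forall i, qlcs (sdp a) q i =
                  sd_set (qtors_closure q (rel_lcs a) i) (qlcs K q i),
        q_almost_direct a q ->
          forall i, qtors_closure q (rel_lcs a) i = qlcs H q i
      & q_almost_direct a q ->
        exists (nS : is_nseries (qlcs (sdp a) q))
               (nH : is_nseries (qlcs H q)) (nK : is_nseries (qlcs K q))
               (hc : sd_compat a (qlcs H q) (qlcs K q))
               (phi : forall i,
                  gr_lie nS i -> glie_sdprod (gr_action nH nK hc) i),
          [/\ is_glie_iso phi,
              forall i (h : H) (k : K), qlcs H q i h -> qlcs K q i k ->
                phi i (gr_cls (nseries_central nS) i ((h, k) : sdp a)) =
                (gr_cls (nseries_central nH) i h,
                 gr_cls (nseries_central nK) i k)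
            & forall i (u : gr_lie nS i),
                phi i.+1 (gr_pow q u) = gr_sd_pow q (phi i u)]]).
Proof.
split; first by split=> [i|]; [rewrite qtors_closure_lcs|apply: qlcs_nseries].
move=> K H a; split=> [i|adq i|adq].
- exact: qlcs_sdp.
- exact: closure_rel_lcs_almost_direct.
have eN : qtors_closure q (rel_lcs a) = qlcs H q.
  by apply: funext => i; apply: closure_rel_lcs_almost_direct.
have hc : sd_compat a (qlcs H q) (qlcs K q).
  by rewrite -eN; apply: closure_rel_lcs_compat.
exists (qlcs_nseries _ q), (qlcs_nseries _ q), (qlcs_nseries _ q), hc.
apply: gr_sd_iso_of_eq; apply: funext => i.
by rewrite qlcs_sdp eN.
Qed.
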